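(* Let $A\colon\mathcal{X}\to 2^{\mathcal{X}^*}$ be maximally monotone, let $f\in\Gamma_0(\mathcal{X})$ be a Legendre function, let $x\in\operatorname{int\,dom}f$, let $u^*\in\mathcal{X}^*$, and let $\gamma\in\,]0,+\infty[$. Suppose that $(\operatorname{int\,dom}f)\cap\operatorname{dom}A\neq\varnothing$ and that one of the following holds: (i) $\gamma u^*+\operatorname{int\,dom}f^*\subset\operatorname{ran}(\nabla f+\gamma A)$. (ii) $(\operatorname{int\,dom}f^* )+\gamma\operatorname{ran}A=\mathcal{X}^*$ and one of the following is satisfied: (a) $A$ is $3^*$ monotone; (b) $\operatorname{dom}A\subset\operatorname{int\,dom}f$. Then $J_{\gamma(A-u^* )}^{\nabla f}x$ is a singleton and, setting $z=J_{\gamma(A-u^* )}^{\nabla f}x$, $$H_A(x,u^* )\geq\frac{D_f(x,z)+D_f(z,x)}{\gamma}.$$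
   Context: $\mathcal{X}\neq\{0\}$ is a reflexive real Banach space with topological dual $\mathcal{X}^*$, and $\langle\cdot,\cdot\rangle$ is the canonical duality pairing. For $A\colon\mathcal{X}\to 2^{\mathcal{X}^*}$: $\operatorname{gra}A=\{(x,x^* )\mid x^*\in Ax\}$, $\operatorname{dom}A=\{x\mid Ax\neq\varnothing\}$, $\operatorname{ran}A=\bigcup_xAx$, $A^{-1}x^*=\{x\mid x^*\in Ax\}$; images of sets and compositions are unions of images. The Haraux function is $H_A\colon\mathcal{X}\times\mathcal{X}^*\to[-\infty,+\infty]\colon(x,u^* )\mapsto\sup_{(y,y^* )\in\operatorname{gra}A}\langle x-y,y^*-u^*\rangle$, and $\operatorname{dom}H_A=\{H_A<+\infty\}$. $A$ is monotone if $\langle x-y,x^*-y^*\rangle\geq0$ for all $(x,x^* ),(y,y^* )\in\operatorname{gra}A$; maximally monotone if, for every $(x,x^* )$, $(x,x^* )\in\operatorname{gra}A$ iff $\langle x-y,x^*-y^*\rangle\geq0$ for every $(y,y^* )\in\operatorname{gra}A$; $3^*$ monotone if it is monotone and $\operatorname{dom}A\times\operatorname{ran}A\subset\operatorname{dom}H_A$. $\gamma(A-u^* )$ is the operator $x\mapsto\{\gamma(x^*-u^* )\mid x^*\in Ax\}$. The warped resolvent of $A$ with kernel $K\colon\mathcal{X}\to2^{\mathcal{X}^*}$ is $J_A^K=(K+A)^{-1}\circ K$; a singleton value is identified with its element. $\Gamma_0(\mathcal{X})$ is the class of proper lower semicontinuous convex functions from $\mathcal{X}$ to $]-\infty,+\infty]$;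 $\partial f$ is the subdifferential and $f^*\colon x^*\mapsto\sup_{x}(\langle x,x^*\rangle-f(x))$ the conjugate. $f\in\Gamma_0(\mathcal{X})$ is a Legendre function if it is essentially smooth ($\partial f$ is both locally bounded and single-valued on its domain) and essentially strictly convex ($\partial f^*$ is locally bounded on its domain and $f$ is strictly convex on every convex subset of $\operatorname{dom}\partial f$). Here $\nabla f$ is viewed as an operator with domain $\operatorname{int\,dom}f$ (empty-valued elsewhere). The Bregman distance is $D_f(x,y)=f(x)-f(y)-\langle x-y,\nabla f(y)\rangle$ if $y\in\operatorname{int\,dom}f$, and $D_f(x,y)=+\infty$ otherwise. *)

(* Defs.v *)
From HB Require Import structures.
From mathcomp Require Import all_boot all_order all_algebra.
From mathcomp Require Import all_classical all_reals all_analysis.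

Set Implicit Arguments.
Unset Strict Implicit.
Unset Printing Implicit Defensive.

Import Order.TTheory GRing.Theory Num.Theory.
Import numFieldNormedType.Exports.

Local Open Scope classical_set_scope.
Local Open Scope ring_scope.

Section Dual.
Context {R : realType} (X : normedModType R).

Definition dual_pred : {pred X -> R^o} :=
  [pred phi : X -> R^o | `[< linear phi /\ continuous phi >]].

(* The topological dual of X; the pairing <x, u> is the application [u x]. *)
Record dual_space := DualSpace {
  dual_fun :> X -> R^o;
  dual_funP : dual_fun \in dual_pred
}.

HB.instance Definition _ := [isSub for dual_fun].
HB.instance Definition _ := [Choice of dual_space by <:].

Lemma dual_pred_submod_closed : submod_closed dual_pred.
Proof.
split=> [|a phi psi /asboolP[lphi cphi] /asboolP[lpsi cpsi]]; apply/asboolP.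
  split=> [b x y|]; first by rewrite scaler0 addr0.
  exact: cst_continuous.
split=> [b x y|x].
  change (a *: phi (b *: x + y) + psi (b *: x + y) =
          b *: (a *: phi x + psi x) + (a *: phi y + psi y)).
  rewrite lphi lpsi !scalerDr !scalerA (mulrC a b) -!addrA; congr (_ + _).
  by rewrite addrCA.
apply: (@continuousD _ _ _ (fun x => a *: phi x) psi); last exact: cpsi.
apply: (@continuous_comp _ _ _ phi ( *:%R a)); first exact: cphi.
exact: scaler_continuous.
Qed.

HB.instance Definition _ :=
  GRing.isSubmodClosed.Build R (X -> R^o) dual_pred dual_pred_submod_closed.
HB.instance Definition _ := [SubChoice_isSubLmodule of dual_space by <:].

Lemma dual_linear (u : dual_space) : linear u.
Proof. by have /asboolP[] := dual_funP u. Qed.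

Lemma dual_continuous (u : dual_space) : continuous u.
Proof. by have /asboolP[] := dual_funP u. Qed.

HB.instance Definition _ (u : dual_space) :=
  GRing.isLinear.Build R X R^o *:%R (dual_fun u) (dual_linear u).

Definition dual_norm (u : dual_space) : R :=
  sup [set `|u x| | x in [set x : X | `|x| <= 1]].

Lemma dual_norm_has_sup (u : dual_space) :
  has_sup [set `|u x| | x in [set x : X | `|x| <= 1]].
Proof.
split; first by exists `|u 0|, 0; rewrite //= normr0.
have /linear_bounded_continuous/bounded_funP/(_ 1)[M uM] :
  continuous (u : {linear X -> R^o}) by exact: dual_continuous.
by exists M => _ [x /= x1 <-]; exact: uM.
Qed.

Lemma dual_normP (u : dual_space) (x : X) : `|x| <= 1 -> `|u x| <= dual_norm u.
Proof.
by move=> x1; apply: (sup_upper_bound (dual_norm_has_sup u)); exists x.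
Qed.

Lemma dual_norm_le (u : dual_space) (M : R) :
  (forall x : X, `|x| <= 1 -> `|u x| <= M) -> dual_norm u <= M.
Proof.
move=> uM; apply: ge_sup; first by case: (dual_norm_has_sup u).
by move=> _ [x /= x1 <-]; exact: uM.
Qed.

Lemma dual_normD (u v : dual_space) : dual_norm (u + v) <= dual_norm u + dual_norm v.
Proof.
apply: dual_norm_le => x x1; apply: (le_trans (ler_normD (u x) (v x))).
by rewrite lerD// dual_normP.
Qed.

Lemma dual_normZ_le (l : R) (u : dual_space) :
  dual_norm (l *: u) <= `|l| * dual_norm u.
Proof.
apply: dual_norm_le => x x1; change (`|l * u x| <= `|l| * dual_norm u).
by rewrite normrM ler_wpM2l// dual_normP.
Qed.

Lemma dual_normZ (l : R) (u : dual_space) : dual_norm (l *: u) = `|l| * dual_norm u.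
Proof.
apply/eqP; rewrite eq_le dual_normZ_le /=.
have [->|l0] := eqVneq l 0.
  rewrite normr0 mul0r (le_trans _ (@dual_normP _ 0 _)) ?normr0//.
rewrite -ler_pdivlMl ?normr_gt0// -normfV.
by rewrite -{1}(scale1r u) -(mulVf l0) -scalerA dual_normZ_le.
Qed.

Lemma dual_norm0_eq0 (u : dual_space) : dual_norm u = 0 -> u = 0.
Proof.
move=> u0; apply/val_inj/funext => x; change (u x = 0 :> R).
have [->|x0] := eqVneq x 0; first exact: linear0.
have nx : `|x| != 0 by rewrite normr_eq0.
have x1 : `|(`|x|^-1 *: x)| <= 1 by rewrite normrZ normfV normr_id mulVf.
have := dual_normP u x1; rewrite u0 normr_le0 linearZ /= scaler_eq0 invr_eq0.
by rewrite (negbTE nx) /= => /eqP.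
Qed.

HB.instance Definition _ :=
  Lmodule_isNormed.Build R dual_space dual_normD dual_normZ dual_norm0_eq0.

End Dual.

(* Surjectivity of the canonical embedding of X into its bidual. *)
Definition reflexive_space {R : realType} (X : normedModType R) :=
  forall phi : dual_space (dual_space X), exists x : X, forall u : dual_space X, phi u = u x.

Section Operators.
Context {R : realType} {X : normedModType R}.
Implicit Types (A B : X -> set (dual_space X)) (x : X) (u : dual_space X).

Definition gra A : set (X * dual_space X) := [set p | A p.1 p.2].
Definition op_dom A : set X := [set x | A x !=set0].
Definition op_ran A : set (dual_space X) := \bigcup_x A x.
Definition op_inv A : dual_space X -> set X := fun u => [set x | A x u].

Definition op_add A B : X -> set (dual_space X) :=
  fun x => [set a + b | a in A x & b in B x].
Definition op_scale (gamma : R) A : X -> set (dual_space X) :=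
  fun x => [set gamma *: a | a in A x].
Definition op_sub A u : X -> set (dual_space X) := fun x => [set a - u | a in A x].

Definition haraux A x u : \bar R :=
  ereal_sup [set ((p.2 - u) (x - p.1))%:E | p in gra A].

Definition monotone A := forall p q, gra A p -> gra A q ->
  0 <= (p.2 - q.2) (p.1 - q.1).

Definition maximally_monotone A := forall p, gra A p <->
  forall q, gra A q -> 0 <= (p.2 - q.2) (p.1 - q.1).

Definition three_star_monotone A := monotone A /\
  op_dom A `*` op_ran A `<=` [set p | (haraux A p.1 p.2 < +oo)%E].

Definition warped_resolvent A (K : X -> set (dual_space X)) : X -> set X :=
  fun x => \bigcup_(u in K x) op_inv (op_add K A) u.

Definition locally_bounded_at A x :=
  exists2 V, nbhs x V & bounded_set (\bigcup_(y in V) A y).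

Definition single_valued_at A x := exists u, A x = [set u].

End Operators.

Section ConvexFunctions.
Context {R : realType} {X : normedModType R}.
Implicit Types (f : X -> \bar R) (x y : X).
Local Open Scope ereal_scope.

Definition fun_dom f : set X := [set x | f x < +oo].

Definition proper f := (forall x, -oo < f x) /\ fun_dom f !=set0.

Definition econvex f := forall x y (t : R), (0 < t < 1)%R ->
  f (t *: x + (1 - t) *: y)%R <= t%:E * f x + (1 - t)%:E * f y.

Definition strictly_convex_on (C : set X) f :=
  forall x y (t : R), C x -> C y -> x <> y -> (0 < t < 1)%R ->
  f (t *: x + (1 - t) *: y)%R < t%:E * f x + (1 - t)%:E * f y.

Definition Gamma0 f := [/\ proper f, lower_semicontinuous f & econvex f].

Definition subdiff f : X -> set (dual_space X) :=
  fun x => [set u | forall y, (u (y - x)%R)%:E + f x <= f y].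

Definition conjugate f : dual_space X -> \bar R :=
  fun u => ereal_sup [set (u x)%:E - f x | x in [set: X]].

Definition essentially_smooth f := forall x, op_dom (subdiff f) x ->
  locally_bounded_at (subdiff f) x /\ single_valued_at (subdiff f) x.

(* Gateaux gradient. Near an interior point of its domain a function of the
   class Gamma0 is finite, so that [fine] is harmless there. *)
Definition grad f : X -> set (dual_space X) := fun x =>
  [set u | (fun_dom f)° x /\
    forall h, is_derive x h (fun y => fine (f y) : R^o) (u h)].

(* For a Legendre function [grad f y] is a singleton when y lies in the
   interior of the domain, and [get] returns its element. *)
Definition bregman f x y : \bar R :=
  if `[< (fun_dom f)° y >] then f x - f y - ((get (grad f y)) (x - y)%R)%:E
  else +oo.

End ConvexFunctions.

Section Legendre.
Context {R : realType} {X : normedModType R}.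
Implicit Types f : X -> \bar R.

(* The subdifferential of the conjugate takes its values in the bidual. *)
Definition essentially_strictly_convex f :=
  (forall u, op_dom (subdiff (conjugate f)) u ->
     locally_bounded_at (subdiff (conjugate f)) u) /\
  (forall C : set X, convex_set C -> C `<=` op_dom (subdiff f) ->
     strictly_convex_on C f).

Definition legendre f :=
  essentially_smooth f /\ essentially_strictly_convex f.

End Legendre.

(* Main.v *)
From HB Require Import structures.
Require Import Defs.
From mathcomp Require Import all_boot all_order all_algebra.
From mathcomp Require Import all_classical all_reals all_analysis.
From mathcomp Require Import ring lra.
Import Order.TTheory GRing.Theory Num.Theory.
Import numFieldNormedType.Exports.
Set Implicit Arguments.
Unset Strict Implicit.
Unset Printing Implicit Defensive.
Local Open Scope classical_set_scope.
Local Open Scope ring_scope.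

(** Let v be the gradient of f at x.  A point z of the resolvent is a solution of
    gamma u + v = g + gamma a, with g the gradient of f at z and a in A z.

    The inequality needs only such a solution: as gamma (a - u) = v - g, the pair
    (z, a) contributes <x - z, v - g> / gamma to the supremum that defines the
    Haraux function, and <x - z, v - g> is the sum of the two Bregman distances
    ([resolvent_haraux_ge]).  Two solutions coincide because A is monotone while
    strict convexity makes the gradient of f strictly monotone
    ([subdiff_strictly_monotone]).

    Existence rests on one duality argument ([pairing_duality]).  Let F be convex
    on the product of X and its dual with F (z, a) >= <z, a>, and let q, r be
    convex functions on X and on the dual with q z + r c >= <z, c>.  Put
    G (z, a) = q z + r (w - a) - <z, w>, so that F + G >= 0.  If G is bounded near
    a point where F is finite, the Hahn-Banach theorem puts a continuous affine
    function between F and - G; by reflexivity its slope is a pair (b, y) with b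
    in the dual and y in X.  When F and G reproduce themselves under conjugation
    and exchange of the two variables, (y, b) is itself a zero of F + G, hence
    F (y, b) = <y, b> and q y + r (w - b) = <y, w - b>.  This is used twice.

    - F is the Fitzpatrick function of gamma A, q is f and r is the conjugate of
      f ([sum_range]).  Then b lies in gamma A y and w - b in the subdifferential
      of f at y, so w is in the range of the sum.  For w = gamma u + v this settles
      hypothesis (ii): the decomposition of w that it provides supplies a point
      where F is finite, either because A is 3* monotone or because one may take a
      point of the graph of A.
    - F (z, a) is f z plus the conjugate of f at a, q is the indicator of a large
      ball and r the corresponding multiple of the norm
      ([subdiff_interior_conjugate]).  Local boundedness of the subdifferential of
      the conjugate keeps y inside the ball, so that b = w; hence the conjugate is
      finite near v, and hypothesis (i) applies to v.

    The boundedness that the duality argument asks for comes from Baire's theorem,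
    on X and on its dual ([convex_locally_bounded]).  For the Legendre function f
    the gradient and the subdifferential are the same operator: at interior points
    a unique subgradient is the derivative ([subdiff_single_grad]), and at a
    boundary point of the domain, whose interior is nonempty, a subgradient is
    never unique, because a normal direction can be added to it ([subdiff_single_interior]). *)

(** * Linear minorants of sublinear functions *)

Section HahnBanach.
Context {R : realType} {E : lmodType R}.
Implicit Types p q : E -> R.

Definition sublinear p :=
  (forall x y, p (x + y) <= p x + p y) /\
  (forall (t : R) x, 0 < t -> p (t *: x) <= t * p x).

Lemma sublinearZ p (t : R) x : sublinear p -> 0 < t -> p (t *: x) = t * p x.
Proof.
move=> [_ ph] t0; apply/eqP; rewrite eq_le ph//=.
have := ph t^-1 (t *: x); rewrite invr_gt0 scalerA mulVf ?gt_eqF// scale1r => /(_ t0).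
by rewrite -ler_pdivrMl ?invr_gt0// invrK.
Qed.

Lemma sublinear0 p : sublinear p -> p 0 = 0.
Proof.
move=> sp; have := @sublinearZ p 2 0 sp (ltr0n _ 2).
rewrite scaler0; lra.
Qed.

Lemma sublinearN p x : sublinear p -> - p (- x) <= p x.
Proof.
move=> sp; have := sp.1 x (- x); rewrite subrr (sublinear0 sp); lra.
Qed.

(** The infimum of p (h + t x0) - t p x0 over t >= 0 is sublinear and lies below
    p, so it equals p by minimality; at h = - x0, t = 1 it is at most - p x0. *)
Lemma sublinear_min_odd p : sublinear p ->
  (forall q, sublinear q -> (forall x, q x <= p x) -> q = p) ->
  forall x, p (- x) = - p x.
Proof.
move=> sp pmin x0.
pose T h : set R := [set p (h + t *: x0) - t * p x0 | t in [set t : R | 0 <= t]].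
have T0 h : T h !=set0 by exists (p (h + 0 *: x0) - 0 * p x0), 0 => /=.
have Tlb h s : T h s -> - p (- h) <= s.
  move=> [t /= t0 <-].
  have tp : p (t *: x0) = t * p x0.
    move: t0; rewrite le_eqVlt => /orP[/eqP<-|t0]; last exact: sublinearZ.
    by rewrite scale0r mul0r sublinear0.
  have := sp.1 (h + t *: x0) (- h).
  by rewrite [h + _]addrC addrK tp; lra.
have Tinf h : has_inf (T h) by split => //; exists (- p (- h)) => s /Tlb.
pose q h := inf (T h).
have qT h s : T h s -> q h <= s by move=> Ts; apply: ge_inf => //; exact: (Tinf h).2.
have qle h (M : R) : (forall s, T h s -> M <= s) -> M <= q h.
  by move=> TM; apply: lb_le_inf.
have sq : sublinear q.
  split=> [x y|t x t0].
    rewrite -lerBlDr; apply: (qle) => _ [t1 /= t10 <-].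
    rewrite lerBlDr -lerBlDl; apply: (qle) => _ [t2 /= t20 <-].
    rewrite lerBlDl.
    have /qT/le_trans : T (x + y) (p (x + y + (t1 + t2) *: x0) - (t1 + t2) * p x0).
      by exists (t1 + t2) => //=; rewrite addr_ge0.
    apply; have := sp.1 (x + t1 *: x0) (y + t2 *: x0).
    rewrite addrACA -scalerDl; lra.
  rewrite mulrC -ler_pdivrMr//; apply: (qle) => _ [s /= s0 <-].
  rewrite ler_pdivrMr//.
  have /qT/le_trans : T (t *: x) (p (t *: x + (t * s) *: x0) - (t * s) * p x0).
    by exists (t * s) => //=; rewrite mulr_ge0 // ltW.
  apply; rewrite -scalerA -scalerDr (sublinearZ _ sp t0); lra.
have qp : q = p.
  apply: pmin => // x; apply: qT; exists 0 => //=.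
  by rewrite scale0r addr0 mul0r subr0.
apply/eqP; rewrite eq_le; apply/andP; split.
  rewrite -{1}qp; apply: qT; exists 1 => //=.
  by rewrite scale1r addNr (sublinear0 sp) mul1r sub0r.
by have := sublinearN (- x0) sp; rewrite opprK; lra.
Qed.

Lemma sublinear_min_linear p : sublinear p ->
  (forall q, sublinear q -> (forall x, q x <= p x) -> q = p) ->
  linear (p : E -> R^o).
Proof.
move=> sp pmin; have pN := sublinear_min_odd sp pmin.
have pD x y : p (x + y) = p x + p y.
  apply/eqP; rewrite eq_le sp.1 /=.
  by have := sp.1 (- x) (- y); rewrite -opprD !pN; lra.
move=> a x y; rewrite pD; congr (_ + _); change (p (a *: x) = a * p x).
have [a0|a0|->] := ltgtP a 0; last by rewrite scale0r mul0r sublinear0.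
  rewrite -(opprK (a *: x)) pN -scaleNr sublinearZ ?oppr_gt0//; lra.
exact: sublinearZ.
Qed.

(** Pointwise infima of chains of sublinear functions are sublinear, so by Zorn's
    lemma there is a minimal one below p, and minimal ones are linear.  Working
    with functions defined everywhere avoids partial linear extensions. *)
Theorem hahn_banach_sublinear p : sublinear p ->
  exists phi : E -> R, linear (phi : E -> R^o) /\ forall x, phi x <= p x.
Proof.
move=> sp.
pose T := {q : E -> R | sublinear q /\ forall x, q x <= p x}.
pose Rel (s t : T) := `[< forall x, sval t x <= sval s x >].
have Tlb (s : T) x : - p (- x) <= sval s x.
  case: s => q /= [sq qp]; apply: le_trans (sublinearN x sq).
  by rewrite lerN2.
have [| | | |[m [sm mp]] mmax] := @Zorn T Rel.
- by move=> t; apply/asboolP.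
- by move=> r s t /asboolP rs /asboolP st; apply/asboolP => x; exact: le_trans (rs x).
- move=> s t /asboolP st /asboolP ts; case: s t st ts => [s Ps] [t Pt] /= st ts.
  by apply/eq_exist/funext => x; apply/eqP; rewrite eq_le st ts.
- move=> A Atot; have [[a0 Aa0]|A0] := pselect (exists a, A a); last first.
    by exists (exist _ p (conj sp (fun x => lexx _))) => s As; case: A0; exists s.
  pose V x : set R := [set sval a x | a in A].
  have V0 x : V x !=set0 by exists (sval a0 x), a0.
  have Vlb x : has_lbound (V x) by exists (- p (- x)) => _ [a _ <-]; exact: Tlb.
  pose q x := inf (V x).
  have qV a x : A a -> q x <= sval a x by move=> Aa; apply: ge_inf => //; exists a.
  have qle x (M : R) : (forall a, A a -> M <= sval a x) -> M <= q x.
    by move=> AM; apply: lb_le_inf => // _ [a Aa <-]; exact: AM.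
  have sq : sublinear q.
    split=> [x y|t x t0].
      rewrite -lerBlDr; apply: (qle) => a Aa.
      rewrite lerBlDr -lerBlDl; apply: (qle) => b Ab; rewrite lerBlDl.
      have [/asboolP ab|/asboolP ba] := Atot _ _ Aa Ab.
        apply: (le_trans (qV _ _ Ab)); apply: (le_trans ((svalP b).1.1 _ _)).
        by rewrite lerD2r.
      apply: (le_trans (qV _ _ Aa)); apply: (le_trans ((svalP a).1.1 _ _)).
      by rewrite lerD2l.
    rewrite mulrC -ler_pdivrMr//; apply: (qle) => a Aa; rewrite ler_pdivrMr//.
    by apply: (le_trans (qV _ _ Aa)); rewrite mulrC; exact: (svalP a).1.2.
  have qp x : q x <= p x by apply: (le_trans (qV _ _ Aa0)); exact: (svalP a0).2.
  exists (exist _ q (conj sq qp)) => s As; apply/asboolP => x /=; exact: qV.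
exists m; split=> //; apply: sublinear_min_linear => // q sq qm.
have qp x : q x <= p x by exact: le_trans (mp x).
have /mmax : Rel (exist _ m (conj sm mp)) (exist _ q (conj sq qp)) by exact/asboolP.
by case.
Qed.

End HahnBanach.

(** * Separation of two convex functions by an affine function *)

Section Sandwich.
Context {R : realType}.

Lemma dual_of_linear_le {E : normedModType R} (phi : E -> R) (C : R) :
  linear (phi : E -> R^o) -> (forall h, phi h <= C * `|h|) ->
  exists u : dual_space E, forall h, u h = phi h.
Proof.
move=> lphi phiC.
pose Phi : {linear E -> R^o} :=
  HB.pack (phi : E -> R^o) (GRing.isLinear.Build R E R^o *:%R (phi : E -> R^o) lphi).
have cphi : continuous (phi : E -> R^o).
  apply: (@linear_bounded_continuous _ _ _ Phi).1.
  apply/linear_boundedP; exists C; split; first exact: num_real.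
  move=> r Cr x; rewrite /= ler_norml; apply/andP; split.
    have := phiC (- x); rewrite normrN.
    have -> : phi (- x) = - phi x by exact: (linearN Phi).
    have : C * `|x| <= r * `|x| by rewrite ler_wpM2r// ltW.
    by lra.
  by apply: (le_trans (phiC _)); rewrite ler_wpM2r// ltW.
have dphi : (phi : E -> R^o) \in @dual_pred R E by apply/asboolP.
by exists (DualSpace dphi).
Qed.

(** Convex functions enter through their epigraphs: P z a reads as the bound a for
    the value at z.  The value +oo is then the absence of a bound, and only real
    inequalities occur. *)
Definition convex_rel {E : lmodType R} (P : E -> R -> Prop) :=
  forall z z' a a' (t : R), 0 < t < 1 -> P z a -> P z' a' ->
    P (t *: z + (1 - t) *: z') (t * a + (1 - t) * a').

(** The perturbation function h -> inf (P z + Q (z + h)) is nonnegative at 0; its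
    directional derivative at 0, when the infimum there is replaced by 0, is the
    sublinear function S below.  Boundedness of Q near p, where P is finite, bounds
    S by a multiple of the norm, so that a linear minorant of S is continuous; its
    opposite is the slope of the affine function. *)
Theorem sandwich {E : normedModType R} (P Q : E -> R -> Prop) p a0 K eps :
  convex_rel P -> convex_rel Q ->
  (forall z a b, P z a -> Q z b -> 0 <= a + b) ->
  P p a0 -> 0 < eps -> (forall z, `|z - p| < eps -> Q z K) ->
  exists (u : dual_space E) (al : R),
    (forall z a, P z a -> u z + al <= a) /\
    (forall z b, Q z b -> - b <= u z + al).
Proof.
move=> cP cQ PQ Pp eps0 QK.
(* The element of T h is a difference quotient of the sum, between a point z of P
   and the point z + t h of Q. *)
pose T h : set R := [set s | exists z a z' b t,
  [/\ 0 < t, P z a, Q z' b, z' = z + t *: h & s = (a + b) / t]].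
have TD h1 h2 s1 s2 : T h1 s1 -> T h2 s2 -> T (h1 + h2) (s1 + s2).
  move=> [z1 [a1 [z1' [b1 [t1 [t10 P1 Q1 e1 ->]]]]]].
  move=> [z2 [a2 [z2' [b2 [t2 [t20 P2 Q2 e2 ->]]]]]].
  (* These weights make both steps contribute the same multiple
     t1 t2 / (t1 + t2) of h1 and h2. *)
  pose l := t2 / (t1 + t2).
  have t120 : 0 < t1 + t2 by exact: addr_gt0.
  have l01 : 0 < l < 1.
    by rewrite divr_gt0//= ltr_pdivrMr// mul1r ltrDr.
  have ml : 1 - l = t1 / (t1 + t2) by rewrite /l; field; rewrite gt_eqF.
  exists (l *: z1 + (1 - l) *: z2), (l * a1 + (1 - l) * a2).
  exists (l *: z1' + (1 - l) *: z2'), (l * b1 + (1 - l) * b2).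
  exists (t1 * t2 / (t1 + t2)); split.
  - by rewrite divr_gt0// mulr_gt0.
  - exact: cP.
  - exact: cQ.
  - rewrite e1 e2 !scalerDr !scalerA addrACA; congr (_ + (_ *: _ + _ *: _)).
      by rewrite /l; field; rewrite gt_eqF.
    by rewrite ml; field; rewrite gt_eqF.
  - by rewrite ml /l; field; rewrite !gt_eqF.
have TZ h (c s : R) : 0 < c -> T h s -> T (c *: h) (c * s).
  move=> c0 [z [a [z' [b [t [t0 Pz Qz e ->]]]]]].
  exists z, a, z', b, (t / c); split=> //.
  - exact: divr_gt0.
  - by rewrite scalerA divfK ?gt_eqF.
  - by field; rewrite !gt_eqF.
have T_ge0 s : T 0 s -> 0 <= s.
  move=> [z [a [z' [b [t [t0 Pz Qz e ->]]]]]].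
  rewrite scaler0 addr0 in e; rewrite e in Qz.
  by rewrite divr_ge0 ?(ltW t0)//; exact: PQ Pz Qz.
have Kp : Q p K by apply: QK; rewrite subrr normr0.
have aK0 : 0 <= a0 + K by exact: PQ Pp Kp.
pose C := 2 * (a0 + K) / eps.
have TC h : h != 0 -> T h (C * `|h|).
  move=> h0; have nh : 0 < `|h| by rewrite normr_gt0.
  exists p, a0, (p + (eps / (2 * `|h|)) *: h), K, (eps / (2 * `|h|)).
  have t0 : 0 < eps / (2 * `|h|) by rewrite divr_gt0// mulr_gt0.
  split=> //.
  - apply: QK; rewrite addrC addKr normrZ gtr0_norm//.
    have -> : eps / (2 * `|h|) * `|h| = eps / 2 by field; rewrite gt_eqF.
    by rewrite ltr_pdivrMr// ltr_pMr// ltr1n.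
  - by rewrite /C; field; rewrite !gt_eqF.
have T00 : T 0 (a0 + K).
  by exists p, a0, p, K, 1; rewrite scaler0 addr0 divr1.
have T0 h : T h !=set0.
  have [->|h0] := eqVneq h 0; first by exists (a0 + K).
  by exists (C * `|h|); exact: TC.
have Tlb h : has_lbound (T h).
  have [s' Ts'] := T0 (- h); exists (- s') => s Ts.
  have := TD _ _ _ _ Ts Ts'; rewrite subrr => /T_ge0; lra.
pose S h := inf (T h).
have ST h s : T h s -> S h <= s by move=> Ts; exact: ge_inf.
have Sle h (M : R) : (forall s, T h s -> M <= s) -> M <= S h.
  by move=> TM; apply: lb_le_inf.
have sS : sublinear S.
  split=> [x y|t x t0].
    rewrite -lerBlDr; apply: (Sle) => s1 Ts1.
    rewrite lerBlDr -lerBlDl; apply: (Sle) => s2 Ts2; rewrite lerBlDl.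
    exact/ST/TD.
  rewrite mulrC -ler_pdivrMr//; apply: (Sle) => s Ts; rewrite ler_pdivrMr//.
  by rewrite mulrC; exact/ST/TZ.
have [phi [lphi phiS]] := hahn_banach_sublinear sS.
have phiC h : - phi h <= C * `|h|.
  have -> : - phi h = phi (- h).
    have := lphi (-1) h 0; rewrite !scaleN1r addr0 => ->.
    have := lphi (-1) 0 0; rewrite !scaleN1r addr0 oppr0 addNr => ->.
    by rewrite addr0.
  apply: (le_trans (phiS _)); have [->|h0] := eqVneq h 0.
    by rewrite oppr0 normr0 mulr0 sublinear0.
  by rewrite -normrN; apply: (ST); apply: (TC); rewrite oppr_eq0.
have lNphi : linear ((fun h => - phi h) : E -> R^o).
  move=> a x y; rewrite lphi opprD; congr (_ + _).
  by change (- (a * phi x) = a * - phi x); rewrite mulrN.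
have [u uE] := dual_of_linear_le lNphi phiC.
have phiPQ z a z' b : P z a -> Q z' b -> phi z' - b <= phi z + a.
  move=> Pz Qz.
  have : phi (z' - z) <= a + b.
    apply: (le_trans (phiS _)); apply: (ST); exists z, a, z', b, 1; split=> //.
      by rewrite scale1r addrC subrK.
    by rewrite divr1.
  have -> : phi (z' - z) = phi z' - phi z.
    by rewrite [z' - z]addrC -(scaleN1r z) lphi scaleN1r addrC.
  lra.
pose W : set R := [set s | exists z b, Q z b /\ s = phi z - b].
have W0 : W !=set0 by exists (phi p - K), p, K.
have Wub : has_ubound W.
  by exists (phi p + a0) => _ [z [b [Qz ->]]]; exact: phiPQ.
exists u, (sup W); split=> z a.
  move=> Pz; rewrite uE addrC lerBlDr addrC; apply: ge_sup => // _ [z' [b [Qz ->]]].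
  exact: phiPQ.
move=> Qz; rewrite uE addrC lerBrDr addrC.
by apply: sup_upper_bound => //; exists z, a.
Qed.

End Sandwich.

(** * The dual space is complete *)

Section DualComplete.
Context {R : realType} {X : normedModType R}.
Implicit Types (u v : dual_space X) (x y : X).

Lemma dualD u v x : (u + v) x = u x + v x.
Proof. by []. Qed.

Lemma dualN u x : (- u) x = - u x.
Proof. by []. Qed.

Lemma dualB u v x : (u - v) x = u x - v x.
Proof. by []. Qed.

Lemma dualZ (a : R) u x : (a *: u) x = a * u x.
Proof. by []. Qed.

Lemma dual_scale u (a : R) x : u (a *: x) = a * u x.
Proof. exact: linearZ. Qed.

Lemma dual_add u x y : u (x + y) = u x + u y.
Proof. exact: linearD. Qed.

Lemma dual_sub u x y : u (x - y) = u x - u y.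
Proof. exact: linearB. Qed.

Lemma ler_dual u x : `|u x| <= `|u| * `|x|.
Proof.
have [->|x0] := eqVneq x 0; first by rewrite linear0 !normr0 mulr0.
have nx : 0 < `|x| by rewrite normr_gt0.
have x1 : `|(`|x|^-1 *: x)| <= 1 by rewrite normrZ normfV normr_id mulVf ?gt_eqF.
have := dual_normP u x1; rewrite linearZ /= normrZ normfV normr_id.
by rewrite ler_pdivrMl// mulrC.
Qed.

Lemma dual_eval x : exists Phi : dual_space (dual_space X), forall u, Phi u = u x.
Proof.
have [||Phi PhiE] := @dual_of_linear_le _ (dual_space X) (fun u => u x) `|x|.
- by move=> a u v.
- by move=> u; rewrite mulrC (le_trans (ler_norm _))// ler_dual.
by exists Phi.
Qed.

(** The pointwise limit of a Cauchy filter is again a bounded functional, and the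
    convergence is uniform on the unit ball. *)
Lemma dual_complete (F : set_system (dual_space X)) :
  ProperFilter F -> cauchy F -> cvg F.
Proof.
move=> FF /cauchy_ballP Fc.
have small (e : R) : 0 < e ->
    exists2 A, F A & forall u v, A u -> A v -> `|u - v| < e.
  move=> e0; have [[A B] /= [FA FB] AB] := Fc e e0.
  exists (A `&` B); first exact: filterI.
  move=> u v [Au _] [_ Bv]; have := AB (u, v) (conj Au Bv).
  by rewrite /= -ball_normE.
have cvx x : cvg ((fun u : dual_space X => u x : R^o) @ F).
  apply: cauchy_cvg; apply: cauchy_exP => e e0.
  have x1 : 0 < `|x| + 1 by rewrite ltr_wpDl.
  have [A FA Ae] := small _ (divr_gt0 e0 x1).
  have [u0 Au0] := filter_ex FA.
  exists (u0 x); change (F [set u : dual_space X | ball (u0 x : R^o) e (u x : R^o)]).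
  apply: (filterS _ FA) => u Au /=; rewrite -ball_normE.
  change (`|(u0 - u) x| < e).
  apply: (le_lt_trans (ler_dual (u0 - u) x)).
  apply: (@le_lt_trans _ _ (e / (`|x| + 1) * `|x|)).
    by rewrite ler_wpM2r// ltW// Ae.
  by rewrite mulrAC ltr_pdivrMr// ltr_pM2l// ltrDl.
pose l x : R^o := lim ((fun u : dual_space X => u x : R^o) @ F).
have lc x : (fun u : dual_space X => u x : R^o) @ F --> l x := cvx x.
have lle x (c k : R) A : F A -> (forall v, A v -> `|v x - c| <= k) -> `|l x - c| <= k.
  move=> FA Ak.
  have vc v : A v -> c - k <= v x <= c + k.
    by move=> /Ak; rewrite ler_distl.
  rewrite ler_distl; apply/andP; split.
    apply: limr_ge; first exact: cvx.
    by apply: (filterS _ FA) => v /vc/andP[].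
  apply: limr_le; first exact: cvx.
  by apply: (filterS _ FA) => v /vc/andP[].
have llin : linear l.
  move=> a x y; apply: (cvg_unique _ (lc (a *: x + y))) => //.
  rewrite (_ : (fun u : dual_space X => _) =
    (fun u : dual_space X => a *: (u x : R^o) + u y)); last first.
    by apply/funext => u; rewrite linearP.
  by apply: cvgD; [apply: cvgZr; exact: lc|exact: lc].
have [A FA A1] := small 1 ltr01.
have [u0 Au0] := filter_ex FA.
have lb x : l x <= (`|u0| + 1) * `|x|.
  have : `|l x - u0 x| <= `|x|.
    apply: (lle _ _ _ A) => // v Av; rewrite -dualB; apply: (le_trans (ler_dual (v - u0) x)).
    by rewrite ler_piMl// ltW// A1.
  have := ler_dual u0 x; rewrite mulrDl mul1r.
  rewrite ler_distl ler_norml; lra.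
have [L LE] := dual_of_linear_le llin lb.
apply/cvg_ex; exists L; apply/cvgrPdist_le => e e0.
have [B FB Be] := small e e0.
apply: (filterS _ FB) => u Bu; apply: dual_norm_le => x x1.
rewrite dualB LE; apply: (lle _ _ _ B) => // v Bv; rewrite -dualB.
apply: (le_trans (ler_dual (v - u) x)).
apply: (@le_trans _ _ (e * 1)); last by rewrite mulr1.
by apply: ler_pM => //; exact/ltW/Be.
Qed.

HB.instance Definition _ := Uniform_isComplete.Build (dual_space X) dual_complete.

End DualComplete.

(** * Convex functions at interior points of their domain *)

Section Baire.
Context {R : realType} {E : completeNormedModType R}.

(** The sublevel sets cover a ball around x, so by Baire's theorem one of them
    contains a ball around some z0.  Averaging with a bound at the reflection
    x + (x - z0) of z0 moves this ball to x. *)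
Lemma convex_locally_bounded (P : E -> R -> Prop) (x : E) :
  convex_rel P -> (forall z a b, P z a -> a <= b -> P z b) ->
  (forall a, closed [set z | P z a]) ->
  [set z | exists a, P z a]° x ->
  exists (eps K : R), 0 < eps /\ forall z, `|z - x| < eps -> P z K.
Proof.
move=> cP Pmon Pcl /nbhs_normP[r /= r0 rP].
have {}rP z : `|z - x| < r -> exists a, P z a.
  by rewrite distrC => zx; exact: rP.
(* U n is the complement of the n-th sublevel set cut down to the closed ball: an
   open set missing some U n then lies in a region where P is known to be finite. *)
pose U (n : nat) : set E := ~` [set z | P z n%:R] `|` ~` closed_ball x (r / 2).
have r20 : 0 < r / 2 by exact: divr_gt0.
have Uo n : open (U n).
  apply: openU; apply: closed_openC; first exact: Pcl.
  exact: closed_ball_closed.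
have [Und] : exists n, ~ dense (U n).
  apply: contrapT => /forallNP dU.
  have dcap : dense (\bigcap_n U n).
    by apply: Baire => n; split; [exact: Uo|exact: contrapT (dU n)].
  have [||z [xz Uz]] := dcap (ball x (r / 2)).
  - by exists x; exact: ballxx.
  - by apply: ball_open.
  have [a Pa] : exists a, P z a.
    apply: rP; move: xz; rewrite -ball_normE /= distrC => /lt_trans; apply.
    by rewrite ltr_pdivrMr// ltr_pMr// ltr1n.
  have [] := Uz (Num.truncn a).+1 Logic.I.
    apply; apply: (Pmon _ _ _ Pa); exact/ltW/truncnS_gt.
  by apply; exact: subset_closed_ball.
move=> /denseNE[V [[z0 [Vo Vz0]] VU]].
have VU0 z : V z -> U Und z -> False.
  by move=> Vz Uz; have : (V `&` U Und) z by []; rewrite VU.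
have VP z : V z -> P z Und%:R.
  by move=> Vz; apply: contrapT => nP; apply: (VU0 z Vz); left.
have z0x : `|z0 - x| <= r / 2.
  have : closed_ball x (r / 2) z0.
    by apply: contrapT => nP; apply: (VU0 z0 Vz0); right.
  by rewrite closed_ballE// /closed_ball_ /= distrC.
have /nbhs_normP[d /= d0 dV] : nbhs z0 V by exact: open_nbhs_nbhs.
have [a Pa] : exists a, P (x + (x - z0)) a.
  apply: rP; rewrite addrC addKr distrC (le_lt_trans z0x)//.
  by rewrite ltr_pdivrMr// ltr_pMr// ltr1n.
exists (d / 2), (2^-1 * Und%:R + (1 - 2^-1) * a); split; first exact: divr_gt0.
move=> w wx.
have -> : w = 2^-1 *: (z0 + 2 *: (w - x)) + (1 - 2^-1) *: (x + (x - z0)).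
  have -> : 1 - 2^-1 = 2^-1 :> R by field.
  rewrite -scalerDr addrACA [z0 + x]addrC -addrA [z0 + _]addrC -addrA subrK.
  rewrite addrCA -mulr2n -[x *+ 2]scaler_nat -scalerDr scalerA mulVf// scale1r.
  by rewrite subrK.
apply: cP; [by lra| |exact: Pa].
apply: VP; apply: dV; rewrite /= opprD addrA subrr sub0r normrN normrZ.
by rewrite gtr0_norm// -ltr_pdivlMl// mulrC.
Qed.

End Baire.

(** * Epigraphs and conjugates *)

Section Epi.
Context {R : realType} {X : normedModType R}.
Implicit Types (f : X -> \bar R) (x y z : X) (u v : dual_space X) (a b c s : R).

Definition epi f z a := (f z <= a%:E)%E.

Lemma epi_mon f z a b : epi f z a -> a <= b -> epi f z b.
Proof. by move=> fa ab; apply: (le_trans fa); rewrite lee_fin. Qed.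

Lemma epi_convex f : econvex f -> convex_rel (epi f).
Proof.
move=> cf z z' a a' t t01 fa fa'; apply: (le_trans (cf _ _ _ t01)).
move: t01 => /andP[t0 t1].
by rewrite (EFinD (t * a)) !EFinM leeD// lee_pmul2l// lte_fin// subr_gt0.
Qed.

Lemma epi_closed f a : lower_semicontinuous f -> closed [set z | epi f z a].
Proof.
move=> /lower_semicontinuousP/(_ a) of_.
rewrite (_ : [set z | _] = ~` [set z | (a%:E < f z)%E]); first exact: open_closedC.
by apply/seteqP; split => z /=; rewrite /epi leNgt => /negP.
Qed.

Lemma fun_domP f x : (forall z, (-oo < f z)%E) ->
  fun_dom f x <-> exists c, f x = c%:E.
Proof.
move=> fN; split=> [|[c fx]]; last by rewrite /fun_dom /= fx ltry.
by rewrite /fun_dom /=; have := fN x; case: (f x) => // c _ _; exists c.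
Qed.

Lemma fun_dom_epi f : fun_dom f = [set z | exists a, epi f z a].
Proof.
apply/seteqP; split=> z /=; rewrite /epi /fun_dom /=.
  by case: (f z) => // [c _|_]; [exists c | exists 0; rewrite leNye].
by move=> [a fa]; apply: (le_lt_trans fa); rewrite ltry.
Qed.

Lemma subdiff_dom f x u : Defs.proper f -> subdiff f x u -> exists c, f x = c%:E.
Proof.
move=> [fN [x0 dx0]] ux; apply/fun_domP => //; rewrite /fun_dom /=.
have := ux x0; move: dx0; rewrite /fun_dom /=.
by case: (f x0) (fN x0) => // c0 _ _; case: (f x) (fN x).
Qed.

(** Subgradients tested on the epigraph, where no infinite value can occur. *)
Lemma subdiffP f x u c : f x = c%:E ->
  subdiff f x u <-> forall z a, epi f z a -> u (z - x) + c <= a.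
Proof.
move=> fx; split=> [ux z a fa|ux z].
  by rewrite -lee_fin EFinD -fx; exact: le_trans (ux z) fa.
rewrite fx -EFinD; case fz : (f z) => [a||]; last 2 first.
- by rewrite leey.
- have : epi f z (u (z - x) + c - 1) by rewrite /epi fz leNye.
  by move=> /ux; rewrite lerBrDr gerDl ler10.
by rewrite lee_fin; apply: ux; rewrite /epi fz.
Qed.

End Epi.

Section Conjugate.
Context {R : realType} {X : normedModType R}.
Implicit Types (f : X -> \bar R) (z : X) (u : dual_space X) (b s : R).

Lemma conjugate_leP f u b : (forall z, (-oo < f z)%E) ->
  (conjugate f u <= b%:E)%E <-> forall z s, epi f z s -> u z - s <= b.
Proof.
move=> fN; split=> [ub z s fs|ub].
  have : ((u z)%:E - f z <= b%:E)%E.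
    by apply: le_trans ub; apply: ereal_sup_ubound; exists z.
  apply: contraTT; rewrite -!ltNge => bs.
  apply: (@lt_le_trans _ _ (u z - s)%:E); first by rewrite lte_fin.
  by rewrite EFinB leeB.
apply: ge_ereal_sup => _ [z _ <-].
case fz : (f z) (fN z) => [s||] // _; last by rewrite addeNy leNye.
by rewrite -EFinB lee_fin; apply: ub; rewrite /epi fz.
Qed.

Lemma conjugate_convex f : (forall z, (-oo < f z)%E) -> convex_rel (epi (conjugate f)).
Proof.
move=> fN u u' b b' t /andP[t0 t1] /conjugate_leP - /(_ fN) ub /conjugate_leP - /(_ fN) ub'.
apply/conjugate_leP => // z s fs.
have := ub _ _ fs; have := ub' _ _ fs.
rewrite dualD !dualZ.
have t1' : 0 < 1 - t by rewrite subr_gt0.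
move=> h1 h2.
have : t * (u z - s) <= t * b by rewrite ler_pM2l.
have : (1 - t) * (u' z - s) <= (1 - t) * b' by rewrite ler_pM2l.
lra.
Qed.

Lemma conjugate_closed f b : (forall z, (-oo < f z)%E) ->
  closed [set u | epi (conjugate f) u b].
Proof.
move=> fN.
rewrite (_ : [set u | _] =
  \bigcap_(p in [set p : X * R | epi f p.1 p.2]) [set u : dual_space X | u p.1 <= b + p.2]).
  apply: closed_bigI => -[z s] /= fs.
  apply: (@preimage_closed _ _ (fun u : dual_space X => u z : R^o) [set r | r <= b + s]).
    have [Phi PhiE] := dual_eval z; rewrite (_ : (fun u : dual_space X => _) = Phi).
      by move=> u _; exact: dual_continuous.
    by apply/funext => u; rewrite PhiE.
  exact: closed_le.
apply/seteqP; split=> u /=.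
  by move=> /conjugate_leP - /(_ fN) ub [z s] /= /ub; rewrite lerBlDr.
by move=> ub; apply/conjugate_leP => // z s fs; rewrite lerBlDr; exact: (ub (z, s)).
Qed.

End Conjugate.

(** * Subgradients and the Gateaux gradient at interior points *)

(** The form of the directional derivative in which the two signs of the increment
    can be treated separately. *)
Lemma is_derive_epsP {R : realType} {X : normedModType R} (F : X -> R^o) (x h : X) (d : R) :
  is_derive x h F d <-> forall e, 0 < e -> exists2 r, 0 < r &
    forall t, t != 0 -> `|t| < r -> `|t^-1 * (F (t *: h + x) - F x) - d| <= e.
Proof.
split=> [dF e e0|H].
  have : (fun t => t^-1 *: ((F \o shift x) (t *: h) - F x)) @ 0^' --> (d : R^o).
    by have <- : 'D_h F x = d; [exact: derive_val|exact: ex_derive].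
  move=> /cvgrPdist_le/(_ e e0); rewrite near_withinE => /nbhs_normP[r /= r0 rP].
  exists r => // t t0 tr; rewrite distrC; apply: (rP t) => //=.
  by rewrite sub0r normrN.
have H' : (fun t => t^-1 *: ((F \o shift x) (t *: h) - F x)) @ 0^' --> (d : R^o).
  apply/cvgrPdist_le => e e0; have [r r0 rP] := H e e0.
  rewrite near_withinE; apply/nbhs_normP; exists r => // t /= tr t0.
  by rewrite distrC; apply: rP => //; rewrite -normrN -sub0r.
by split; [apply/cvg_ex; exists d|exact: cvg_lim].
Qed.

Section Subgradients.
Context {R : realType} {X : completeNormedModType R} (f : X -> \bar R).
Context (f_Gamma0 : Gamma0 f).
Implicit Types (x y z h : X) (u v : dual_space X) (a b c s t : R).

Let f_proper : Defs.proper f. Proof. by case: f_Gamma0. Qed.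
Let f_lsc : lower_semicontinuous f. Proof. by case: f_Gamma0. Qed.
Let f_convex : econvex f. Proof. by case: f_Gamma0. Qed.
Let fN z : (-oo < f z)%E. Proof. by case: f_proper. Qed.

Lemma Gamma0_locally_bounded x : (fun_dom f)° x ->
  exists (eps K : R), 0 < eps /\ forall z, `|z - x| < eps -> epi f z K.
Proof.
move=> xi; apply: convex_locally_bounded.
- exact: epi_convex.
- by move=> z a b; exact: epi_mon.
- by move=> a; exact: epi_closed.
- by rewrite -fun_dom_epi.
Qed.

(** An affine lower bound with slope s along the half-line from x in direction h
    extends to the whole space: the sandwich argument is applied to f, bounded near
    x, and to the opposite of that bound on the half-line.  Since x lies on the
    half-line, the affine function touches f at x. *)
Lemma subgradient_along x h c s : (fun_dom f)° x -> f x = c%:E ->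
  (forall t a, 0 <= t -> epi f (x + t *: h) a -> c + t * s <= a) ->
  exists2 u, subdiff f x u & s <= u h.
Proof.
move=> xi fx fs.
have [eps [K [eps0 fK]]] := Gamma0_locally_bounded xi.
pose P z b := exists t, [/\ 0 <= t, z = x + t *: h & - (c + t * s) <= b].
have [] := @sandwich _ X P (epi f) x (- c) K eps => //.
- move=> z z' b b' t /andP[t0 t1] [r [r0 -> rb]] [r' [r'0 -> r'b]].
  exists (t * r + (1 - t) * r'); split.
  + by rewrite addr_ge0// mulr_ge0// ltW// subr_gt0.
  + rewrite !scalerDr addrACA -scalerDl !scalerA -scalerDl.
    by rewrite [t + (1 - t)]addrC subrK scale1r.
  + have t1' : 0 < 1 - t by rewrite subr_gt0.
    have : t * (- (c + r * s)) <= t * b by rewrite ler_pM2l.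
    have : (1 - t) * (- (c + r' * s)) <= (1 - t) * b' by rewrite ler_pM2l.
    nra.
- exact: epi_convex.
- by move=> z a b [t [t0 -> ta]] /(fs _ _ t0); lra.
- by exists 0; rewrite scale0r addr0 mul0r addr0.
move=> u [al [uP uQ]].
have ux : u x + al = - c.
  apply/eqP; rewrite eq_le; apply/andP; split.
    by apply: uP; exists 0; rewrite scale0r addr0 mul0r addr0.
  by apply: uQ; rewrite /epi fx.
exists (- u).
  apply/(subdiffP _ fx) => z a /uQ; rewrite dualN linearB /=; lra.
have : u (x + h) + al <= - (c + s).
  by apply: uP; exists 1; rewrite scale1r mul1r.
by rewrite dualN linearD /=; lra.
Qed.

Lemma subdiff_nonempty x : (fun_dom f)° x -> exists u, subdiff f x u.
Proof.
move=> xi; have /fun_domP -/(_ fN)[c fx] := interior_subset xi.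
have [|u ux _] := @subgradient_along x 0 c 0 xi fx; last by exists u.
by move=> t a _; rewrite scaler0 addr0 mulr0 addr0 /epi fx lee_fin.
Qed.

Lemma epi_fine z a : epi f z a -> exists2 b, f z = b%:E & b <= a.
Proof.
rewrite /epi; case: (f z) (fN z) => // b _; rewrite lee_fin; by exists b.
Qed.

(** By convexity the difference quotient of f from x towards z is at most
    f z - f x, for every step in the interval from 0 to 1. *)
Lemma grad_subdiff x u : grad f x u -> subdiff f x u.
Proof.
move=> [xi ud]; have /fun_domP -/(_ fN)[c fx] := interior_subset xi.
apply/(subdiffP _ fx) => z a fa.
have /is_derive_epsP ue := ud (z - x).
rewrite leNgt; apply/negP => ac.
have [d d0 dP] := ue ((u (z - x) + c - a) / 2) ltac:(lra).
pose t := Num.min (d / 2) (1 / 2).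
have t0 : 0 < t by rewrite lt_min; apply/andP; split; lra.
have td : t <= d / 2 by rewrite ge_min lexx.
have t1 : t <= 1 / 2 by rewrite ge_min lexx orbT.
have := dP t; rewrite gt_eqF// gtr0_norm// fx /= => /(_ isT ltac:(lra)).
have /epi_fine[b -> /= bac] : epi f (t *: (z - x) + x) (t * a + (1 - t) * c).
  have -> : t *: (z - x) + x = t *: z + (1 - t) *: x.
    by rewrite scalerBr scalerBl scale1r -addrA [- _ + _]addrC.
  apply: epi_convex => //; first by apply/andP; split; lra.
  by rewrite /epi fx.
rewrite ler_distl => /andP[+ _].
have : t^-1 * (b - c) <= a - c by rewrite ler_pdivrMl//; lra.
lra.
Qed.

(** If the difference quotients along h stayed above u h + e, there would be a
    subgradient of slope at least u h + e along h, which is not u.  A step t0 with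
    a smaller quotient bounds all quotients of smaller steps, as they increase with
    the step. *)
Lemma subdiff_single_slope x u c h e : (fun_dom f)° x -> f x = c%:E ->
  subdiff f x = [set u] -> 0 < e ->
  exists2 d, 0 < d & forall t, 0 < t -> t < d ->
    exists b, [/\ f (t *: h + x) = b%:E, t * u h <= b - c & b - c <= t * (u h + e)].
Proof.
move=> xi fx ux e0.
have uu : subdiff f x u by rewrite ux.
have [t0 [a [t00 fa act]]] : exists t0 a, [/\ 0 < t0, epi f (x + t0 *: h) a &
    a < c + t0 * (u h + e)].
  apply: contrapT => H.
  have [|v] := @subgradient_along x h c (u h + e) xi fx.
    move=> t a; rewrite le_eqVlt => /orP[/eqP<-|t0] fa.
      by move: fa; rewrite scale0r addr0 mul0r addr0 /epi fx lee_fin.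
    by rewrite leNgt; apply/negP => ac; apply: H; exists t, a.
  by rewrite ux => ->; lra.
exists t0 => // t tp tt0.
have /epi_fine[b fb ba] : epi f (t *: h + x) (t / t0 * a + (1 - t / t0) * c).
  have -> : t *: h + x = (t / t0) *: (x + t0 *: h) + (1 - t / t0) *: x.
    rewrite scalerDr scalerA divfK ?gt_eqF// addrAC -scalerDl.
    by rewrite [t / t0 + _]addrC subrK scale1r addrC.
  apply: epi_convex => //; last by rewrite /epi fx.
  by rewrite divr_gt0//= ltr_pdivrMr// mul1r.
exists b; split=> //.
  have /(subdiffP _ fx) /(_ (t *: h + x) b) := uu.
  by rewrite addrK dual_scale /epi fb lexx => /(_ isT); lra.
have : (t / t0) * (a - c) <= (t / t0) * (t0 * (u h + e)).
  by rewrite ler_pM2l ?divr_gt0//; lra.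
rewrite [leRHS]mulrA divfK ?gt_eqF//; lra.
Qed.

Lemma subdiff_single_grad x u : (fun_dom f)° x -> subdiff f x = [set u] ->
  grad f x = [set u].
Proof.
move=> xi ux; apply/seteqP; split=> [v /grad_subdiff|_ ->].
  by rewrite ux.
have /fun_domP -/(_ fN)[c fx] := interior_subset xi.
split=> // h; apply/is_derive_epsP => e e0.
have [d1 d10 d1P] := @subdiff_single_slope x u c h e xi fx ux e0.
have [d2 d20 d2P] := @subdiff_single_slope x u c (- h) e xi fx ux e0.
exists (Num.min d1 d2); first by rewrite lt_min d10.
move=> t; rewrite fx /= lt_min => t0 /andP[t1 t2].
have [tn|tp|tE] := ltgtP t 0; last by rewrite tE eqxx in t0.
  have mt : 0 < - t by rewrite oppr_gt0.
  rewrite ltr0_norm// in t2.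
  have [b []] := d2P _ mt t2; rewrite scaleNr scalerN opprK linearN /= => -> /= h1 h2.
  rewrite ler_distl; apply/andP; split.
    rewrite -(opprK (t^-1)) -invrN mulNr lerNr ler_pdivrMl//; lra.
  rewrite -(opprK (t^-1)) -invrN mulNr lerNl ler_pdivlMl//; lra.
rewrite gtr0_norm// in t1.
have [b []] := d1P _ tp t1 => -> /= h1 h2.
rewrite ler_distl ler_pdivlMl// ler_pdivrMl//; apply/andP; split; lra.
Qed.

End Subgradients.

(** * The domain of the subdifferential and the biconjugate *)

Section ConvexSets.
Context {R : realType} {X : normedModType R}.
Implicit Types (D : set X) (x y z : X) (t : R).

(** The ball of radius r around x is shrunk by the factor t towards w. *)
Lemma interior_segment D x w t :
  (forall z z' t, 0 < t < 1 -> D z -> D z' -> D (t *: z + (1 - t) *: z')) ->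
  D° x -> D w -> 0 < t <= 1 -> D° (t *: x + (1 - t) *: w).
Proof.
move=> cD /nbhs_normP[r /= r0 rD] Dw /andP[t0 t1].
apply/nbhs_normP; exists (t * r); first exact: mulr_gt0.
move=> z /= zr.
have xD : D (x + t^-1 *: (z - (t *: x + (1 - t) *: w))).
  apply: rD; rewrite /= opprD addrA subrr sub0r normrN normrZ gtr0_norm ?invr_gt0//.
  by rewrite ltr_pdivrMl// distrC.
have -> : z = t *: (x + t^-1 *: (z - (t *: x + (1 - t) *: w))) + (1 - t) *: w.
  by rewrite scalerDr scalerA divff ?gt_eqF// scale1r addrAC addrC subrK.
move: t1; rewrite le_eqVlt => /orP[/eqP t1|t1]; last by apply: cD => //; apply/andP.
by move: xD; rewrite t1 !subrr !scale0r !addr0 !scale1r.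
Qed.

End ConvexSets.

Section DomainAndBiconjugate.
Context {R : realType} {X : completeNormedModType R} (f : X -> \bar R).
Context (f_Gamma0 : Gamma0 f).
Implicit Types (x y z h : X) (u v : dual_space X) (a b c s t : R).

Let f_proper : Defs.proper f. Proof. by case: f_Gamma0. Qed.
Let f_lsc : lower_semicontinuous f. Proof. by case: f_Gamma0. Qed.
Let f_convex : econvex f. Proof. by case: f_Gamma0. Qed.
Let fN z : (-oo < f z)%E. Proof. by case: f_proper. Qed.

Lemma fun_dom_convex z z' t : 0 < t < 1 -> fun_dom f z -> fun_dom f z' ->
  fun_dom f (t *: z + (1 - t) *: z').
Proof.
rewrite fun_dom_epi => t01 [a fa] [a' fa'].
by exists (t * a + (1 - t) * a'); exact: epi_convex.
Qed.

Lemma interior_fun_dom_convex : convex_set (fun_dom f)°.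
Proof.
apply/convex_setW => x y; rewrite !inE => xi yi k k0 k1.
rewrite inE; apply: (interior_segment fun_dom_convex xi (interior_subset yi)).
by rewrite k0 ltW.
Qed.

(** If y is not interior, the gauge of the domain about x0, encoded by Q, is at
    least 1 at y.  Separating it from the value -1 at the single point y gives a
    nonzero v with v y <= v z on the domain.  Then u - v is a second subgradient at
    y. *)
Lemma subdiff_single_interior x0 y : (fun_dom f)° x0 ->
  single_valued_at (subdiff f) y -> (fun_dom f)° y.
Proof.
move=> x0i [u uy]; apply: contrapT => yi.
have uu : subdiff f y u by rewrite uy.
have [c fy] := subdiff_dom f_proper uu.
have Dy : fun_dom f y by rewrite /fun_dom /= fy ltry.
pose Q z b := 0 < b /\ fun_dom f (x0 + b^-1 *: (z - x0)).
pose P z a := z = y /\ -1 <= a.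
have /nbhs_normP[r /= r0 rD] := x0i.
pose K := (`|y - x0| + 1) / r.
have K0 : 0 < K by rewrite divr_gt0// ltr_wpDl.
have [] := @sandwich _ X P Q y (-1) K 1 => //.
- move=> z z' a a' t /andP[t0 t1] [-> aP] [-> a'P]; split.
    by rewrite -scalerDl [t + _]addrC subrK scale1r.
  have t1' : 0 < 1 - t by rewrite subr_gt0.
  nra.
- move=> z z' b b' t /andP[t0 t1] [b0 Qz] [b'0 Qz'].
  have t1' : 0 < 1 - t by rewrite subr_gt0.
  have B0 : 0 < t * b + (1 - t) * b' by rewrite addr_gt0// mulr_gt0.
  split=> //; set B := t * b + _ in B0 *.
  pose l := t * b / B.
  have l1 : 1 - l = (1 - t) * b' / B by rewrite /l /B; field; rewrite gt_eqF.
  have -> : x0 + B^-1 *: (t *: z + (1 - t) *: z' - x0) =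
      l *: (x0 + b^-1 *: (z - x0)) + (1 - l) *: (x0 + b'^-1 *: (z' - x0)).
    rewrite !scalerDr addrACA -scalerDl [l + _]addrC subrK scale1r !scalerA.
    congr (_ + _); rewrite l1.
    have -> : l / b = B^-1 * t by rewrite /l; field; rewrite !gt_eqF.
    have -> : (1 - t) * b' / B / b' = B^-1 * (1 - t) by field; rewrite !gt_eqF.
    rewrite addrACA; congr (_ + _).
    rewrite !scalerN -opprD -scalerDl -mulrDr [t + _]addrC subrK mulr1 //.
  apply: fun_dom_convex => //; rewrite divr_gt0 ?mulr_gt0//= ltr_pdivrMr//.
  by rewrite mul1r /B ltrDl mulr_gt0.
- move=> z a b [-> am1] [b0 Qy]; suff : 1 <= b by lra.
  rewrite leNgt; apply/negP => b1; apply: yi.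
  have -> : y = (1 - b) *: x0 + (1 - (1 - b)) *: (x0 + b^-1 *: (y - x0)).
    have -> : 1 - (1 - b) = b by lra.
    rewrite scalerDr scalerA divff ?gt_eqF// scale1r scalerBl scale1r.
    by rewrite addrA subrK addrC subrK.
  apply: interior_segment => //; first exact: fun_dom_convex.
  by apply/andP; split; lra.
- move=> z zy; split=> //; apply: rD => /=; have {}zy : `|z - y + (y - x0)| < `|y - x0| + 1.
    by rewrite (le_lt_trans (ler_normD _ _))// [ltRHS]addrC ltrD2r.
  rewrite opprD addrA subrr sub0r normrN normrZ gtr0_norm ?invr_gt0//.
  rewrite /K invf_div mulrAC ltr_pdivrMr ?ltr_wpDl// ltr_pM2l//.
  by move: zy; rewrite addrA subrK.
move=> v [al [vP vQ]].
have vy : v y + al <= -1 by exact: vP.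
have vx0 : 0 <= v x0 + al.
  rewrite leNgt; apply/negP => vx0.
  have : - (- (v x0 + al) / 2) <= v x0 + al.
    apply: vQ; split; first lra.
    by rewrite subrr scaler0 addr0; exact: interior_subset x0i.
  lra.
have vD z : fun_dom f z -> v y <= v z.
  move=> Dz; have : -1 <= v z + al.
    by apply: vQ; split => //; rewrite invr1 scale1r addrC subrK.
  lra.
have : subdiff f y (u - v).
  apply/(subdiffP _ fy) => z a fa.
  have /(subdiffP _ fy)/(_ _ _ fa) := uu.
  have : v y <= v z by apply: vD; rewrite fun_dom_epi; exists a.
  rewrite dualB !linearB /=; lra.
rewrite uy /= => uv.
have v0 z : v z = 0.
  by have := congr1 (fun w : dual_space X => w z) uv; rewrite dualB; lra.
by move: vy vx0; rewrite !v0; lra.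
Qed.

(** The strict convexity inequality at the midpoint contradicts the sum of the two
    subgradient inequalities there. *)
Lemma subdiff_strictly_monotone x y u v :
  strictly_convex_on (fun_dom f)° f ->
  (fun_dom f)° x -> (fun_dom f)° y -> subdiff f x u -> subdiff f y v ->
  (u - v) (x - y) <= 0 -> x = y.
Proof.
move=> sf xi yi xu yv uv; apply: contrapT => xy.
have [a fx] := subdiff_dom f_proper xu.
have [b fy] := subdiff_dom f_proper yv.
have h01 : 0 < (2^-1 : R) < 1 by apply/andP; split; lra.
have := sf x y 2^-1 xi yi xy h01; rewrite fx fy -!EFinM -EFinD => fm.
have [m fmE mab] := epi_fine f_Gamma0 (ltW fm).
move: fm; rewrite fmE lte_fin => fm.
set w := 2^-1 *: x + _ in fmE.
have fw : epi f w m by rewrite /epi fmE.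
have /(subdiffP _ fx)/(_ _ _ fw) h1 := xu.
have /(subdiffP _ fy)/(_ _ _ fw) h2 := yv.
move: h1 h2 uv; rewrite /w dualB !dual_sub !dual_add !dual_scale; lra.
Qed.

(** The Fenchel-Moreau theorem, in the form: a bound for the biconjugate at y is a
    bound for f at y.  By convexity and lower semicontinuity, for K' < f y and N
    large f lies above the concave function K' - N |z - y|.  That function is
    locally bounded, so an affine function passes between the two; it is at least
    K' at y. *)
Lemma Gamma0_biconjugate y K :
  (forall v b, epi (conjugate f) v b -> v y - b <= K) -> epi f y K.
Proof.
move=> fK; rewrite /epi leNgt; apply/negP => Kf.
have [K' KK' K'f] : exists2 K', K < K' & (K'%:E < f y)%E.
  case: (f y) Kf => [b||//]; last by exists (K + 1); rewrite ?ltry ?ltrDl.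
  by rewrite lte_fin => Kb; exists ((K + b) / 2); rewrite ?lte_fin; lra.
have lsc x a : (a%:E < f x)%E ->
    exists2 e, 0 < e & forall z b, `|z - x| < e -> epi f z b -> a < b.
  move=> /f_lsc[V /nbhs_normP[e /= e0 eV] Va]; exists e => // z b zx fb.
  by rewrite -lte_fin; apply: lt_le_trans fb; apply/Va/eV; rewrite /= distrC.
have [e e0 ef] := lsc _ _ K'f.
have [_ [x0]] := f_proper; move=> /fun_domP -/(_ fN)[c fx0].
have [d d0 df] := lsc x0 (c - 1) ltac:(by rewrite fx0 lte_fin; lra).
(* Outside the ball of radius d the slope of f from x0 is controlled by the value
   of f at distance d / 2 from x0. *)
pose C := 2 / d.
have C0 : 0 < C by exact: divr_gt0.
have fC z a : epi f z a -> c - 1 - C * `|z - x0| <= a.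
  move=> fa; have [zd|zd] := ltP `|z - x0| d.
    have := df _ _ zd fa; have : 0 <= C * `|z - x0| by rewrite mulr_ge0// ltW.
    lra.
  pose t := d / 2 / `|z - x0|.
  have zx0 : 0 < `|z - x0| by exact: lt_le_trans zd.
  have t0 : 0 < t by rewrite divr_gt0// divr_gt0.
  have t1 : t < 1 by rewrite ltr_pdivrMr// mul1r; lra.
  have ft : epi f (t *: z + (1 - t) *: x0) (t * a + (1 - t) * c).
    by apply: epi_convex => //; [apply/andP|rewrite /epi fx0].
  have : c - 1 < t * a + (1 - t) * c.
    apply: df ft; rewrite scalerBl scale1r addrA addrAC addrK -scalerBr normrZ.
    by rewrite gtr0_norm// /t divfK ?gt_eqF//; lra.
  move=> h; have : t * (c - a) < 1 by lra.
  rewrite -ltr_pdivlMl// mulr1 /t invfM invrK invf_div => h'.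
  by rewrite /C; lra.
pose N := C + Num.max 0 ((K' - c + 1 + C * `|y - x0|) / e).
have N0 : 0 <= N by rewrite addr_ge0 ?(ltW C0)// le_max lexx.
have fNy z a : epi f z a -> K' - N * `|z - y| <= a.
  move=> fa; have [ze|ze] := ltP `|z - y| e.
    have := ef _ _ ze fa; have : 0 <= N * `|z - y| by rewrite mulr_ge0.
    lra.
  have := fC _ _ fa.
  have : C * `|z - x0| <= C * `|z - y| + C * `|y - x0|.
    by rewrite -mulrDr ler_pM2l// -(subrK y z) -addrA (subrK y z) ler_normD.
  have : K' - c + 1 + C * `|y - x0| <= (N - C) * `|z - y|.
    apply: (@le_trans _ _ ((N - C) * e)).
      rewrite -ler_pdivrMr// /N [C + _]addrC addrK le_max lexx orbT//.
    by rewrite ler_wpM2l// /N [C + _]addrC addrK le_max lexx.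
  lra.
have [] := @sandwich _ X (epi f) (fun z b => - b <= K' - N * `|z - y|)
    x0 c (N * (1 + `|x0 - y|) - K') 1.
- exact: epi_convex.
- move=> z z' b b' t /andP[t0 t1] zb zb'.
  have t1' : 0 < 1 - t by rewrite subr_gt0.
  have : `|t *: z + (1 - t) *: z' - y| <= t * `|z - y| + (1 - t) * `|z' - y|.
    rewrite -[X in X * `|z - y|]gtr0_norm// -[X in X * `|z' - y|]gtr0_norm//.
    rewrite -!normrZ; apply: le_trans (ler_normD _ _).
    by rewrite !scalerBr addrACA -opprD -scalerDl [t + _]addrC subrK scale1r.
  move=> /(ler_wpM2l N0) h.
  have : t * - b <= t * (K' - N * `|z - y|) by rewrite ler_pM2l.
  have : (1 - t) * - b' <= (1 - t) * (K' - N * `|z' - y|) by rewrite ler_pM2l.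
  lra.
- by move=> z a b /fNy; lra.
- by rewrite /epi fx0.
- by [].
- move=> z zx0; suff : N * `|z - y| <= N * (1 + `|x0 - y|) by lra.
  rewrite ler_wpM2l// -(subrK x0 z) -addrA (le_trans (ler_normD _ _))// lerD2r.
  exact: ltW.
move=> u [al [uP uQ]].
have uy : K' <= u y + al.
  by rewrite -(opprK K'); apply: uQ; rewrite subrr normr0 mulr0 subr0 opprK.
have /fK : epi (conjugate f) u (- al).
  by apply/conjugate_leP => // z s /uP; lra.
lra.
Qed.

End DomainAndBiconjugate.

(** * Duality on the product of the space and its dual *)

Section Duality.
Context {R : realType} {X : normedModType R}.
Context (X_reflexive : reflexive_space X).
Local Notation Y := (dual_space X).

(** Reflexivity represents the functional on the second factor by a point. *)
Lemma dual_prodE (Phi : dual_space (X * Y)%type) :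
  exists (y : X) (b : Y), forall z (a : Y), Phi (z, a) = b z + a y.
Proof.
have PhiE z a : Phi (z, a) = Phi (z, 0) + Phi (0, a).
  by rewrite -dual_add; congr (Phi _); congr (_, _); rewrite /= ?addr0 ?add0r.
have [||b bE] := @dual_of_linear_le _ X (fun z => Phi (z, 0)) `|Phi|.
- move=> t z z'; change (Phi (t *: z + z', 0) = t * Phi (z, 0) + Phi (z', 0)).
  rewrite -dual_scale -dual_add; congr (Phi _).
  by congr (_, _); rewrite /= scaler0 addr0.
- move=> z; apply: (le_trans (ler_norm _)); apply: (le_trans (ler_dual _ _)).
  by rewrite ler_wpM2l// prod_normE /= normr0 ge_max lexx normr_ge0.
have [||eta etaE] := @dual_of_linear_le _ Y (fun a => Phi (0, a)) `|Phi|.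
- move=> t z z'; change (Phi (0, t *: z + z') = t * Phi (0, z) + Phi (0, z')).
  rewrite -dual_scale -dual_add; congr (Phi _).
  by congr (_, _); rewrite /= scaler0 addr0.
- move=> z; apply: (le_trans (ler_norm _)); apply: (le_trans (ler_dual _ _)).
  by rewrite ler_wpM2l// prod_normE /= normr0 ge_max lexx normr_ge0.
have [y yE] := X_reflexive eta.
by exists y, b => z a; rewrite PhiE bE -etaE yE.
Qed.

(** The separation of F from the opposite of
    (z, a) -> q z + r (w - a) - <z, w>.  The first conclusion bounds the conjugate
    of F at (b, y) by - al; the second bounds the conjugate of q at w - b plus that
    of r at y by <y, w> + al. *)
Lemma pairing_duality (F : X * Y -> R -> Prop) (q : X -> R -> Prop)
    (r : Y -> R -> Prop) (w : Y) (p : X) (p' : Y) (a0 eps K : R) :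
  convex_rel F -> convex_rel q -> convex_rel r ->
  (forall z a s, F (z, a) s -> a z <= s) ->
  (forall z c s t, q z s -> r c t -> c z <= s + t) ->
  F (p, p') a0 -> 0 < eps ->
  (forall z, `|z - p| < eps -> q z K) ->
  (forall c, `|c - (w - p')| < eps -> r c K) ->
  exists (y : X) (b : Y) (al : R),
    (forall z a s, F (z, a) s -> b z + a y + al <= s) /\
    (forall z c s t, q z s -> r c t -> (w - b) z - s + (c y - t) <= w y + al).
Proof.
move=> cF cq cr Fp qr Fpp eps0 qK rK.
pose Q (za : X * Y) e :=
  exists s t, [/\ q za.1 s, r (w - za.2) t & s + t - w za.1 <= e].
have [] := @sandwich _ (X * Y)%type F Q (p, p') a0
    (K + K + `|w| * (`|p| + eps)) eps => //.
- move=> [z a] [z' a'] e e' l /andP[l0 l1] [s [t /= [qs rt ste]]].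
  move=> [s' [t' /= [qs' rt' ste']]].
  have l1' : 0 < 1 - l by rewrite subr_gt0.
  exists (l * s + (1 - l) * s'), (l * t + (1 - l) * t'); split=> /=.
  + by apply: cq => //; apply/andP.
  + have -> : w - (l *: a + (1 - l) *: a') = l *: (w - a) + (1 - l) *: (w - a').
      by rewrite !scalerBr addrACA -opprD -scalerDl [l + _]addrC subrK scale1r.
    by apply: cr => //; apply/andP.
  + rewrite dual_add !dual_scale.
    have : l * (s + t - w z) <= l * e by rewrite ler_pM2l.
    have : (1 - l) * (s' + t' - w z') <= (1 - l) * e' by rewrite ler_pM2l.
    lra.
- move=> [z a] e e' /Fp az [s [t /= [qs rt ste]]].
  by have := qr _ _ _ _ qs rt; rewrite dualB; lra.
- move=> [z a]; rewrite prod_normE /= gt_max => /andP[zp ap].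
  exists K, K; split=> /=.
  + exact: qK.
  + by apply: rK; rewrite opprB addrC addrA subrK distrC.
  + have : `|w z| <= `|w| * (`|p| + eps).
      apply: (le_trans (ler_dual _ _)); rewrite ler_wpM2l//.
      rewrite -(subrK p z) (le_trans (ler_normD _ _))//.
      by rewrite [leRHS]addrC lerD2r ltW.
    by rewrite ler_norml; lra.
move=> Phi [al [PF PQ]]; have [y [b PhiE]] := dual_prodE Phi.
exists y, b, al; split=> [z a s /PF|z c s t qs rt]; first by rewrite PhiE.
have : - (s + t - w z) <= Phi (z, w - c) + al.
  by apply: PQ; exists s, t; split=> //=; rewrite opprB addrC subrK.
rewrite PhiE !dualB; lra.
Qed.

End Duality.

(** * Solvability of monotone inclusions *)

Section Solvability.
Context {R : realType} {X : completeNormedModType R} (f : X -> \bar R).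
Context (X_reflexive : reflexive_space X).
Context (f_Gamma0 : Gamma0 f).
Local Notation Y := (dual_space X).
Implicit Types (x y z : X) (u v w : Y).

Let f_proper : Defs.proper f. Proof. by case: f_Gamma0. Qed.
Let f_convex : econvex f. Proof. by case: f_Gamma0. Qed.
Let fN z : (-oo < f z)%E. Proof. by case: f_proper. Qed.

Lemma conjugate_fin u b : epi (conjugate f) u b -> exists2 c, conjugate f u = c%:E & c <= b.
Proof.
have [_ [x0 /fun_domP -/(_ fN)[c fx0]]] := f_proper.
have ul : ((u x0 - c)%:E <= conjugate f u)%E.
  by apply: ereal_sup_ubound; exists x0 => //; rewrite fx0.
rewrite /epi; case: (conjugate f u) ul => [d|//|//].
by rewrite !lee_fin => _ db; exists d.
Qed.

Lemma conjugate_locally_bounded v : (fun_dom (conjugate f))° v ->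
  exists (eps K : R), 0 < eps /\ forall c, `|c - v| < eps -> epi (conjugate f) c K.
Proof.
move=> vi; apply: convex_locally_bounded.
- exact: conjugate_convex.
- by move=> z a b; exact: epi_mon.
- by move=> a; exact: conjugate_closed.
- by rewrite -fun_dom_epi.
Qed.

(** F is the Fitzpatrick function of B.  By maximality it dominates the pairing,
    with equality on the graph of B.  The conjugate of r, the biconjugate of f, is
    f itself, so Fenchel's inequality for f at y and w - b gives - <y, b> <= al;
    with this, the bound on the conjugate of F says that (y, b) is monotonically
    related to B, hence belongs to its graph, and that al = - <y, b>.  Equality in
    Fenchel's inequality follows. *)
Lemma sum_range (B : X -> set Y) w p p' a0 :
  maximally_monotone B -> (fun_dom f)° p -> (fun_dom (conjugate f))° (w - p') ->
  (forall y b, B y b -> b p + p' y - b y <= a0) ->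
  exists y b, B y b /\ subdiff f y (w - b).
Proof.
move=> Bm /(Gamma0_locally_bounded f_Gamma0)[e1 [K1 [e10 fK]]].
move=> /conjugate_locally_bounded[e2 [K2 [e20 cK]]] Ba0.
pose F (za : X * Y) s := forall y b, B y b -> b za.1 + za.2 y - b y <= s.
have Bmon z a z' a' : B z a -> B z' a' -> 0 <= (a - a') (z - z').
  by move=> Bz Bz'; exact: ((Bm (z, a)).1 Bz (z', a')).
have FB z a : B z a -> F (z, a) (a z).
  move=> Bz z' a' Bz' /=; have := Bmon _ _ _ _ Bz Bz'.
  by rewrite dualB !dual_sub; lra.
have [] := @pairing_duality _ X X_reflexive F (epi f) (epi (conjugate f)) w p p' a0
   (Num.min e1 e2) (Num.max K1 K2).
- move=> [z a] [z' a'] s s' t /andP[t0 t1] Fs Fs' y b Byb /=.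
  have := Fs _ _ Byb; have := Fs' _ _ Byb => /= h' h.
  have t1' : 0 < 1 - t by rewrite subr_gt0.
  change (b (t *: z + (1 - t) *: z') + (t *: a + (1 - t) *: a') y - b y
    <= t * s + (1 - t) * s').
  rewrite dualD !dualZ dual_add !dual_scale.
  have : t * (b z + a y - b y) <= t * s by rewrite ler_pM2l.
  have : (1 - t) * (b z' + a' y - b y) <= (1 - t) * s' by rewrite ler_pM2l.
  lra.
- exact: epi_convex.
- exact: conjugate_convex.
- move=> z a s Fs; have [Bza|nBza] := pselect (B z a).
    by have := Fs _ _ Bza => /=; lra.
  have [[y b] [Byb ab]] : exists q, gra B q /\ (a - q.2) (z - q.1) < 0.
    apply: contrapT => H; apply: nBza; apply: (Bm (z, a)).2 => q Bq /=.
    by rewrite leNgt; apply/negP => ab; apply: H; exists q.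
  have {}ab : (a - b) (z - y) < 0 by [].
  have := Fs _ _ Byb; move: ab; rewrite dualB !dual_sub => ab /=; lra.
- by move=> z c s t fs /conjugate_leP - /(_ fN)/(_ _ _ fs); lra.
- by [].
- by rewrite lt_min e10.
- by move=> z; rewrite lt_min => /andP[/fK fz _]; apply: (epi_mon fz); rewrite le_max lexx.
- move=> c; rewrite lt_min => /andP[_ /cK fz]; apply: (epi_mon fz).
  by rewrite le_max lexx orbT.
move=> y [b [al [H1 H2]]].
have cwp : epi (conjugate f) (w - p') K2 by apply: cK; rewrite subrr normr0.
have cwb c t : epi (conjugate f) c t ->
    epi (conjugate f) (w - b) (w y + al - (c y - t)).
  by move=> ct; apply/conjugate_leP => // z s fs; have := H2 _ _ _ _ fs ct; lra.
have [be beE _] := conjugate_fin (cwb _ _ cwp).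
have cbe : epi (conjugate f) (w - b) be by rewrite /epi beE.
have /(epi_fine f_Gamma0)[eta fy etab] : epi f y (w y + al - be).
  apply: Gamma0_biconjugate => // c t /cwb.
  by rewrite /epi beE lee_fin; lra.
have fbe z s : epi f z s -> (w - b) z - s <= be.
  by move: cbe => /conjugate_leP -/(_ fN); exact.
have aly : - b y <= al.
  have : (w - b) y - eta <= be by apply: fbe; rewrite /epi fy.
  rewrite dualB; lra.
have Byb : B y b.
  apply: (Bm (y, b)).2 => -[z a] Bza; change (0 <= (b - a) (y - z)).
  by have := H1 _ _ _ (FB _ _ Bza); rewrite dualB !dual_sub; lra.
have alE : al = - b y.
  have := H1 _ _ _ (FB _ _ Byb); lra.
exists y, b; split=> //; apply/(subdiffP _ fy) => z s /fbe.
rewrite dual_sub; move: etab; rewrite alE !dualB; lra.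
Qed.

Lemma conjugate_subdiff x v c : f x = c%:E -> subdiff f x v ->
  conjugate f v = (v x - c)%:E.
Proof.
move=> fx xv; apply/eqP; rewrite eq_le; apply/andP; split.
  apply/conjugate_leP => // z s fs; have /(subdiffP _ fx)/(_ _ _ fs) := xv.
  by rewrite dual_sub; lra.
by apply: ereal_sup_ubound; exists x => //; rewrite fx.
Qed.

Lemma op_dom_subdiff_conjugate x v : subdiff f x v ->
  op_dom (subdiff (conjugate f)) v.
Proof.
move=> xv; have [c fx] := subdiff_dom f_proper xv.
have [Phi PhiE] := dual_eval x; exists Phi.
apply/(subdiffP _ (conjugate_subdiff fx xv)) => w b /conjugate_leP -/(_ fN).
by move=> /(_ x c); rewrite /epi fx lexx dual_sub !PhiE => /(_ isT); lra.
Qed.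

(** For w near v, duality in the ball of radius rho yields b and y, with y a
    subgradient of the conjugate at b and rho |w - b| = <y, w - b>.  Monotonicity
    between (v, x) and (b, y) makes |w - b| at most a multiple of |w - v|, so b is
    in the neighbourhood of v where subgradients are bounded by M.  As M < rho, the
    equality forces w = b, where the conjugate is finite. *)
Lemma subdiff_interior_conjugate x v : subdiff f x v ->
  locally_bounded_at (subdiff (conjugate f)) v -> (fun_dom (conjugate f))° v.
Proof.
move=> xv [V /nbhs_normP[d /= d0 dV] [M0 [M0r M0P]]].
have [c fx] := subdiff_dom f_proper xv.
pose M := `|M0| + 1.
have M_ge1 : 1 <= M by rewrite lerDr.
have VM b Phi : `|v - b| < d -> subdiff (conjugate f) b Phi -> `|Phi| <= M.
  move=> vb bPhi; apply: (M0P M); last by exists b => //; exact: dV.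
  by rewrite (le_lt_trans (ler_norm _))// ltrDl.
have fv := conjugate_subdiff fx xv.
(* rho exceeds M, for the final contradiction, and |x| + 1, so that x is interior
   to the ball; d / k keeps b at distance less than d from v. *)
pose rho := M + `|x| + 1.
have x0 := normr_ge0 x.
have rho0 : 0 < rho by rewrite /rho; lra.
pose k := (rho + `|x|) / (rho - `|x|) + 1.
have rx0 : 0 < rho - `|x| by rewrite /rho; lra.
have k0 : 0 < k by rewrite ltr_wpDl// divr_ge0//; lra.
apply/nbhs_normP; exists (d / k); first exact: divr_gt0.
move=> w /= vw.
pose F (za : X * Y) s := exists s1 s2,
  [/\ epi f za.1 s1, epi (conjugate f) za.2 s2 & s1 + s2 <= s].
have [] := @pairing_duality _ X X_reflexive F
   (fun z s => `|z| <= rho /\ 0 <= s) (fun c t => rho * `|c| <= t)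
   w x v (v x) 1 (rho * (1 + `|w - v|)).
- move=> [z a] [z' a'] s s' t t01 [s1 [s2 /= [fs fa ss]]] [s1' [s2' /= [fs' fa' ss']]].
  exists (t * s1 + (1 - t) * s1'), (t * s2 + (1 - t) * s2'); split=> /=.
  + exact: epi_convex.
  + exact: conjugate_convex.
  + move: t01 => /andP[t0 t1].
    have t1' : 0 < 1 - t by rewrite subr_gt0.
    have : t * (s1 + s2) <= t * s by rewrite ler_pM2l.
    have : (1 - t) * (s1' + s2') <= (1 - t) * s' by rewrite ler_pM2l.
    lra.
- move=> z z' s s' t /andP[t0 t1] [zr s0] [zr' s0'].
  have t1' : 0 < 1 - t by rewrite subr_gt0.
  split; last by rewrite addr_ge0// mulr_ge0// ltW.
  rewrite (le_trans (ler_normD _ _))// !normrZ !gtr0_norm//.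
  have : t * `|z| <= t * rho by rewrite ler_pM2l.
  have : (1 - t) * `|z'| <= (1 - t) * rho by rewrite ler_pM2l.
  lra.
- move=> z z' s s' t /andP[t0 t1] zr zr'.
  have t1' : 0 < 1 - t by rewrite subr_gt0.
  have : `|t *: z + (1 - t) *: z'| <= t * `|z| + (1 - t) * `|z'|.
    by rewrite (le_trans (ler_normD _ _))// !normrZ !gtr0_norm.
  move=> /(ler_wpM2l (ltW rho0)).
  have : t * (rho * `|z|) <= t * s by rewrite ler_pM2l.
  have : (1 - t) * (rho * `|z'|) <= (1 - t) * s' by rewrite ler_pM2l.
  lra.
- move=> z a s [s1 [s2 /= [fs /conjugate_leP - /(_ fN)/(_ _ _ fs)]]]; lra.
- move=> z a s t [zr s0] /(le_trans _) at_; rewrite -[leLHS]add0r lerD//.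
  apply: at_; apply: (le_trans (ler_norm _)); apply: (le_trans (ler_dual _ _)).
  by rewrite mulrC ler_wpM2r.
- exists c, (v x - c); split=> /=; rewrite /epi ?fx ?fv//; lra.
- by [].
- move=> z zx; split; last by rewrite mulr_ge0 ?(ltW rho0)// addr_ge0.
  by have := lerB_dist z x; rewrite /rho; lra.
- move=> a aw; rewrite ler_wpM2l ?(ltW rho0)//.
  by have := lerB_dist a (w - v); lra.
move=> y [b [al [H1 H2]]].
have [Phi PhiE] := dual_eval y.
have N0 := normr_ge0 (w - b); set N := `|w - b| in N0 *.
have z0 : `|0 : X| <= rho /\ 0 <= (0 : R) by rewrite normr0 ltW.
(* The conjugate of the indicator of the ball at w - b is rho |w - b|. *)
have wbN : rho * N <= w y + al.
  rewrite mulrC -ler_pdivlMr//; apply: dual_norm_le => z z1.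
  rewrite ler_pdivlMr// mulrC -{1}(gtr0_norm rho0) -normrM -dual_scale.
  have c0 : rho * `|0 : Y| <= 0 by rewrite normr0 mulr0.
  have zr (s : R) : `|s| = 1 -> `|(s * rho) *: z| <= rho /\ 0 <= (0 : R).
    by move=> s1; rewrite normrZ normrM s1 mul1r gtr0_norm// ler_piMr// ltW.
  have := H2 _ _ _ _ (zr 1 (normr1 _)) c0.
  have := H2 _ _ _ _ (zr (-1) (normrN1 _)) c0.
  rewrite !dual_scale ler_norml !subr0 (_ : (0 : Y) y = 0)//.
  move=> h1 h2; apply/andP; split; lra.
(* Testing with c = t a for large t shows that y lies in the ball of radius rho,
   in the form that pairing with y is bounded by rho times the norm. *)
have yrho (a : Y) : a y <= rho * `|a|.
  rewrite leNgt; apply/negP => ay.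
  pose t := (`|w y + al| + 1) / (a y - rho * `|a|).
  have t0 : 0 < t by rewrite divr_gt0 ?subr_gt0// ltr_wpDl.
  have := H2 0 (t *: a) 0 (rho * `|t *: a|) z0 (lexx _).
  rewrite linear0 dualZ normrZ gtr0_norm// subr0.
  have -> : 0 + (t * a y - rho * (t * `|a|)) = t * (a y - rho * `|a|) by ring.
  rewrite /t divfK; last by rewrite gt_eqF// subr_gt0.
  by have := ler_norm (w y + al); lra.
have aly : - b y <= al.
  by have := yrho (w - b); rewrite dualB -/N; lra.
have cb a t : epi (conjugate f) a t -> epi (conjugate f) b (- al - (a y - t)).
  move=> at_; apply/conjugate_leP => // z s fs.
  have : b z + a y + al <= s + t by apply: H1; exists s, t.
  lra.
have fv' : epi (conjugate f) v (v x - c) by rewrite /epi fv.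
have [be beE _] := conjugate_fin (cb _ _ fv').
have bbe : epi (conjugate f) b be by rewrite /epi beE.
have cb' a t : epi (conjugate f) a t -> a y + al + be <= t.
  by move=> /cb; rewrite /epi beE lee_fin; lra.
have alE : al = - b y by have := cb' _ _ bbe; lra.
have bPhi : subdiff (conjugate f) b Phi.
  apply/(subdiffP _ beE) => a t /cb'.
  by rewrite dual_sub !PhiE alE; lra.
have bx : b x - c <= be.
  by move: bbe => /conjugate_leP -/(_ fN); apply; rewrite /epi fx.
have vb := cb' _ _ fv'.
have wx : (w - b) x <= N * `|x| by rewrite (le_trans (ler_norm _))// ler_dual.
have wvx : - (w - v) x <= `|w - v| * `|x|.
  by rewrite -dualN (le_trans (ler_norm _))// (le_trans (ler_dual _ _))// normrN.
have wvy := yrho (w - v).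
have Nd : N * (rho - `|x|) <= (rho + `|x|) * `|w - v|.
  by move: wbN wx wvx wvy vb; rewrite !dualB alE; lra.
have vbd : `|v - b| < d.
  have -> : v - b = (v - w) + (w - b) by rewrite addrA subrK.
  apply: (le_lt_trans (ler_normD _ _)); rewrite -/N.
  have : N <= (rho + `|x|) / (rho - `|x|) * `|w - v|.
    by rewrite mulrAC ler_pdivlMr.
  have : k * `|v - w| < d by rewrite mulrC -ltr_pdivlMr.
  by rewrite [`|w - v|]distrC /k; lra.
have : (w - b) y <= M * N.
  rewrite -PhiE (le_trans (ler_norm _))// (le_trans (ler_dual _ _))//.
  by rewrite ler_wpM2r// (VM b).
have : rho * N = M * N + (`|x| + 1) * N by rewrite /rho; ring.
have xN : 0 <= `|x| * N by rewrite mulr_ge0.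
move=> h1 h2.
have /eqP : N = 0 by move: wbN h2; rewrite dualB alE; lra.
by rewrite normr_eq0 subr_eq0 => /eqP ->; rewrite /fun_dom /= beE ltry.
Qed.

End Solvability.

(** * Legendre functions and warped resolvents *)

Section LegendreGradient.
Context {R : realType} {X : completeNormedModType R} (f : X -> \bar R).
Context (f_Gamma0 : Gamma0 f).
Context (f_legendre : legendre f).
Implicit Types (x y : X) (u v : dual_space X).

Lemma legendre_grad_interior y : (fun_dom f)° y ->
  exists v, subdiff f y = [set v] /\ grad f y = [set v].
Proof.
move=> yi; have [v yv] := subdiff_nonempty f_Gamma0 yi.
have [_ [w yw]] := f_legendre.1 y (ex_intro _ v yv).
by exists w; split=> //; exact: subdiff_single_grad.
Qed.

(** A subgradient at y is the only one there, so y is interior, where the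
    gradient is that subgradient. *)
Lemma legendre_subdiff_grad x y u : (fun_dom f)° x -> subdiff f y u -> grad f y u.
Proof.
move=> xi yu; have [_ sy] := f_legendre.1 y (ex_intro _ u yu).
have [v [fyv ->]] :=
  legendre_grad_interior (subdiff_single_interior f_Gamma0 xi sy).
by rewrite -fyv.
Qed.

Lemma bregmanE x y g : (fun_dom f)° y -> grad f y = [set g] ->
  bregman f x y = (f x - f y - (g (x - y))%:E)%E.
Proof. 
move=> yi gy; rewrite /bregman asboolT// gy.
by have -> : get [set g] = g by apply: (@getPex _ [set g]); exists g. Qed.

End LegendreGradient.

Section Operators.
Context {R : realType} {X : normedModType R}.
Implicit Types (A : X -> set (dual_space X)) (x y : X) (u v : dual_space X).

Lemma maximally_monotone_scale A (gamma : R) : 0 < gamma ->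
  maximally_monotone A -> maximally_monotone (op_scale gamma A).
Proof.
move=> g0 Am [z b]; split=> [[a /= Aza <-] [y b'] [c /= Ayc <-]|H].
  change (0 <= (gamma *: a - gamma *: c) (z - y)).
  rewrite -scalerBr dualZ mulr_ge0// ?(ltW g0)//.
  exact: ((Am (z, a)).1 Aza (y, c)).
exists (gamma^-1 *: b); last by rewrite scalerA divff ?gt_eqF// scale1r.
apply: (Am (z, gamma^-1 *: b)).2 => -[y c] Ayc.
have := H (y, gamma *: c) (ex_intro2 _ _ c Ayc erefl).
change (0 <= (b - gamma *: c) (z - y) -> 0 <= (gamma^-1 *: b - c) (z - y)).
have -> : b - gamma *: c = gamma *: (gamma^-1 *: b - c).
  by rewrite scalerBr scalerA divff ?gt_eqF// scale1r.
by rewrite dualZ pmulr_rge0.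
Qed.

Lemma haraux_ge A x u y b : A y b -> (((b - u) (x - y))%:E <= haraux A x u)%E.
Proof. by move=> Ayb; apply: ereal_sup_ubound; exists (y, b). Qed.

Lemma warped_resolventP A (K : X -> set (dual_space X)) (gamma : R) u x v z :
  K x = [set v] ->
  warped_resolvent (op_scale gamma (op_sub A u)) K x z <->
  exists g a, [/\ K z g, A z a & gamma *: u + v = g + gamma *: a].
Proof.
move=> Kx; split.
  move=> [w]; rewrite Kx => -> [g zg [_ [_ [a Aza <-] <-] <-]].
  by exists g, a; split=> //; rewrite addrC -addrA -scalerDr subrK.
move=> [g [a [zg Aza e]]]; exists v; first by rewrite Kx.
exists g => //; exists (gamma *: (a - u)).
  by exists (a - u) => //; exists a.
by rewrite scalerBr addrA -e addrC addKr.
Qed.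

End Operators.

Section LegendreResolvent.
Context {R : realType} {X : completeNormedModType R} (f : X -> \bar R).
Context (X_reflexive : reflexive_space X).
Context (f_Gamma0 : Gamma0 f).
Context (f_legendre : legendre f).

(** Finiteness of the Haraux function of A at (p, w) is finiteness of the
    Fitzpatrick function of gamma A at (p, gamma w), as they differ by the pairing
    and the factor gamma. *)
Lemma sum_range_haraux (A : X -> set (dual_space X)) (gamma : R) p v w :
  maximally_monotone A -> 0 < gamma -> (fun_dom f)° p ->
  (fun_dom (conjugate f))° v -> (haraux A p w < +oo)%E ->
  op_ran (op_add (grad f) (op_scale gamma A)) (v + gamma *: w).
Proof.
move=> Am g0 pi vi Hpw.
have [h hP] : exists h : R, forall y b, A y b -> (b - w) (p - y) <= h.
  case hE : (haraux A p w) Hpw => [h||] // _.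
    by exists h => y b /(haraux_ge p w); rewrite hE lee_fin.
  by exists 0 => y b /(haraux_ge p w); rewrite hE.
have [||y [b [[a Aya <-] yb]]] :=
  @sum_range _ _ f X_reflexive f_Gamma0 (op_scale gamma A) (v + gamma *: w) p
    (gamma *: w) (gamma * (h + w p)) (maximally_monotone_scale g0 Am) pi.
- by rewrite addrK.
- move=> y _ [b Ayb <-]; have := hP _ _ Ayb.
  rewrite dualB dual_sub dual_sub !dualZ => hb.
  have : gamma * (b p + w y - b y) <= gamma * (h + w p) by rewrite ler_pM2l//; lra.
  lra.
exists y => //; exists (v + gamma *: w - gamma *: a).
  exact (legendre_subdiff_grad f_Gamma0 f_legendre pi yb).
by exists (gamma *: a); [exists a|rewrite subrK].
Qed.

Lemma resolvent_haraux_ge (A : X -> set (dual_space X)) (gamma : R) x z u v g a :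
  0 < gamma -> (fun_dom f)° x -> (fun_dom f)° z ->
  grad f x = [set v] -> grad f z = [set g] -> A z a ->
  gamma *: u + v = g + gamma *: a ->
  ((bregman f x z + bregman f z x) * (gamma^-1)%:E <= haraux A x u)%E.
Proof.
move=> g0 xi zi xv zg Aza e.
have fN y : (-oo < f y)%E by case: f_Gamma0 => -[].
have /(fun_domP _ fN)[c fx] := interior_subset xi.
have /(fun_domP _ fN)[d fz] := interior_subset zi.
rewrite (bregmanE _ zi zg) (bregmanE _ xi xv) fx fz.
rewrite -!EFinB -EFinD -EFinM.
have -> : (c - d - g (x - z) + (d - c - v (z - x))) / gamma = (a - u) (x - z).
  apply: (mulIf (lt0r_neq0 g0)); rewrite divfK ?gt_eqF// mulrC -dualZ.
  have -> : gamma *: (a - u) = v - g.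
    by apply: (addrI g); rewrite scalerBr addrA -e addrC addKr addrC subrK.
  by rewrite dualB !dual_sub; ring.
exact: haraux_ge.
Qed.

End LegendreResolvent.

Unset Implicit Arguments.
Theorem proposition5p9 (R : realType) (X : completeNormedModType R)
  (X_neq0 : exists x0 : X, x0 != 0) (X_reflexive : reflexive_space X)
  (A : X -> set (dual_space X)) (A_max : maximally_monotone A)
  (f : X -> \bar R) (f_Gamma0 : Gamma0 f) (f_legendre : legendre f)
  (x : X) (x_int : (fun_dom f)° x) (u : dual_space X)
  (gamma : R) (gamma_gt0 : 0 < gamma)
  (dom_meet : (fun_dom f)° `&` op_dom A !=set0)
  (cond :
    [set gamma *: u + v | v in (fun_dom (conjugate f))°]
      `<=` op_ran (op_add (grad f) (op_scale gamma A))
    \/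
    [set v + gamma *: w | v in (fun_dom (conjugate f))° & w in op_ran A]
      = [set: dual_space X]
    /\ (three_star_monotone A \/ op_dom A `<=` (fun_dom f)°)) :
  exists z : X,
    warped_resolvent (op_scale gamma (op_sub A u)) (grad f) x = [set z] /\
    ((bregman f x z + bregman f z x) * (gamma^-1)%:E <= haraux A x u)%E.
Proof.
have [v [subx gradx]] := legendre_grad_interior f_Gamma0 f_legendre x_int.
have xv : subdiff f x v by rewrite subx.
have Am : Defs.monotone A by move=> p q Ap; exact: ((A_max p).1 Ap q).
have vi : (fun_dom (conjugate f))° v.
  apply: (subdiff_interior_conjugate X_reflexive f_Gamma0 xv).
  by apply: f_legendre.2.1; exact: op_dom_subdiff_conjugate xv.
have [z [g [a [zg Aza e]]]] : exists z g a,
    [/\ grad f z g, A z a & gamma *: u + v = g + gamma *: a].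
  suff [z _ [g zg [_ [a Aza <-] e]]] :
      op_ran (op_add (grad f) (op_scale gamma A)) (gamma *: u + v).
    by exists z, g, a; split.
  case: cond => [|[ranT HA]]; first by apply; exists v.
  have [v0 v0i [w0 [q _ Aqw0] <-]] :
      [set v + gamma *: w | v in (fun_dom (conjugate f))° & w in op_ran A]
        (gamma *: u + v) by rewrite ranT.
  case: HA => [[_ A3]|domA].
    have [p [pi pA]] := dom_meet.
    apply: (sum_range_haraux _ f_Gamma0 f_legendre A_max gamma_gt0 pi v0i) => //.
    by apply: (A3 (p, w0)); split=> //; exists q.
  apply: (sum_range_haraux _ f_Gamma0 f_legendre A_max gamma_gt0 _ v0i) => //.
    by apply: (domA q); exists w0.
  apply: (@le_lt_trans _ _ 0%E); last exact: ltry.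
  apply: ge_ereal_sup => _ [[y b] Ayb <-] /=; rewrite lee_fin.
  change ((b - w0) (q - y) <= 0).
  by have := Am (q, w0) (y, b) Aqw0 Ayb; rewrite !dualB; lra.
have zi : (fun_dom f)° z by case: zg.
have [g' [subz gradz]] := legendre_grad_interior f_Gamma0 f_legendre zi.
move: zg; rewrite gradz => gg'; rewrite /= in gg'; subst g'.
exists z; split; last first.
  exact: (resolvent_haraux_ge f_Gamma0 gamma_gt0 x_int zi gradx gradz Aza e).
apply/seteqP; split=> [z'|_ ->]; last first.
  by apply/(warped_resolventP _ _ _ _ gradx); exists g, a; split=> //; rewrite gradz.
move=> /(warped_resolventP _ _ _ _ gradx)[h [b [zh Azb e']]].
have zg : subdiff f z g by rewrite subz.
have sf : strictly_convex_on (fun_dom f)° f.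
  apply: f_legendre.2.2; first exact: interior_fun_dom_convex.
  by move=> y /(subdiff_nonempty f_Gamma0).
apply/esym.
apply: (subdiff_strictly_monotone f_Gamma0 sf zi _ zg (grad_subdiff f_Gamma0 zh)).
  by case: zh.
have -> : g - h = - (gamma *: (a - b)).
  rewrite scalerBr opprB; apply/eqP.
  by rewrite subr_eq addrAC eq_sym subr_eq [_ + h]addrC -e' e.
have := Am (z, a) (z', b) Aza Azb.
change (0 <= (a - b) (z - z') -> (- (gamma *: (a - b))) (z - z') <= 0).
by move=> ab; rewrite dualN dualZ oppr_le0 mulr_ge0// ltW.
Qed.
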